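(* Let $0<\lambda<1$ and $\zeta_\lambda(z)=\lambda\frac{z}{z+1}e^{-z}$, $z\in\mathbb{C}$. Let $A(0)=\{z\in\hat{\mathbb{C}}:\zeta_\lambda^{n}(z)\to 0 \text{ as } n\to\infty\}$ be the basin of attraction of the attracting fixed point $0$. Then the Julia set satisfies $J(\zeta_\lambda)=\hat{\mathbb{C}}\setminus A(0)$.
   Context: $\hat{\mathbb{C}}$ is the extended complex plane. For the transcendental meromorphic function $\zeta_\lambda$, the Fatou set $F(\zeta_\lambda)$ is the set of points of $\hat{\mathbb{C}}$ having a neighbourhood on which all iterates $\zeta_\lambda^{n}$ are defined and form a normal family; the Julia set $J(\zeta_\lambda)$ is its complement $\hat{\mathbb{C}}\setminus F(\zeta_\lambda)$. *)

(* Defs.v *)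
From Stdlib Require Import Reals.
From Coquelicot Require Import Coquelicot.
Open Scope R_scope.

Definition Cexp (z : C) : C :=
  (exp (fst z) * cos (snd z), exp (fst z) * sin (snd z)).

(* Extended complex plane: None is the point at infinity. *)
Definition Chat := option C.

Definition chord (a b : Chat) : R :=
  match a, b with
  | Some z, Some w =>
      2 * Cmod (Cminus z w) / sqrt ((1 + Cmod z ^ 2) * (1 + Cmod w ^ 2))
  | Some z, None | None, Some z => 2 / sqrt (1 + Cmod z ^ 2)
  | None, None => 0
  end.

(* One application of zeta_lambda(z) = lambda * z/(z+1) * e^{-z} as a
   partial map of the sphere: undefined (None) at infinity (essential
   singularity), infinity at the pole z = -1. *)
Definition zeta_step (lam : R) (w : Chat) : option Chat :=
  match w with
  | None => None
  | Some z =>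
      if Req_EM_T (Cmod (Cplus z (RtoC 1))) 0 then Some None
      else Some (Some (Cmult (Cmult (RtoC lam) (Cdiv z (Cplus z (RtoC 1))))
                             (Cexp (Copp z))))
  end.

(* n-th iterate; None means "not defined". *)
Fixpoint zeta_iter (lam : R) (n : nat) (w : Chat) : option Chat :=
  match n with
  | O => Some w
  | S m => match zeta_iter lam m w with
           | Some v => zeta_step lam v
           | None => None
           end
  end.

(* Value of the n-th iterate (default irrelevant where defined). *)
Definition zeta_iter_val (lam : R) (n : nat) (w : Chat) : Chat :=
  match zeta_iter lam n w with Some v => v | None => None end.

Definition chord_ball (w : Chat) (r : R) (v : Chat) : Prop := chord w v < r.

Definition iterates_defined_on (lam : R) (U : Chat -> Prop) : Prop :=
  forall n v, U v -> zeta_iter lam n v <> None.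

Definition loc_unif_cvg (F : nat -> Chat -> Chat) (g : Chat -> Chat)
  (U : Chat -> Prop) : Prop :=
  forall w, U w -> exists r, 0 < r /\ (forall v, chord w v < r -> U v) /\
    forall eps, 0 < eps -> exists N, forall k, (N <= k)%nat ->
      forall v, chord w v < r -> chord (F k v) (g v) < eps.

Definition iterates_normal_on (lam : R) (U : Chat -> Prop) : Prop :=
  forall m : nat -> nat, exists (phi : nat -> nat) (g : Chat -> Chat),
    (forall k, (phi k < phi (S k))%nat) /\
    loc_unif_cvg (fun k => zeta_iter_val lam (m (phi k))) g U.

Definition Fatou (lam : R) (w : Chat) : Prop :=
  exists r, 0 < r /\ iterates_defined_on lam (chord_ball w r) /\
            iterates_normal_on lam (chord_ball w r).

Definition Julia (lam : R) (w : Chat) : Prop := ~ Fatou lam w.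

Definition basin0 (lam : R) (w : Chat) : Prop :=
  (forall n, zeta_iter lam n w <> None) /\
  forall eps, 0 < eps -> exists N, forall n, (N <= n)%nat ->
    chord (zeta_iter_val lam n w) (Some (RtoC 0)) < eps.

(* Main.v *)
Require Import Defs.
From Stdlib Require Import Reals Lra Lia Wf_nat Classical IndefiniteDescription.
From Coquelicot Require Import Coquelicot.
Open Scope R_scope.

(** Write [f] for zeta_lambda. The half-strip [Re z >= 0, |Im z| <= PI / 2] is mapped into itself
    with [|f z| <= lam |z|], so it lies in the basin of [0]. In the metric [|dz| / |z|] the map [f]
    stretches by [|q z|], where [q z = z f'(z) / f(z) = 1 / (z + 1) - z]. Outside the half-strip and
    a disc around [0], [|q|] is close to [1] or smaller only near the critical point
    [- (1 + sqrt 5) / 2]. Points so close to it that [|q| <= 1/2] are mapped into the half-strip;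
    the others, unless they are mapped there too, are mapped far to the right, and this is made up
    for by the weight [1 + max (0, Re z) / 2]. Hence [f] is uniformly expanding for the weighted
    metric along every orbit outside the basin.

    This makes the basin dense in every open set where all iterates are defined. Otherwise
    [cot (arg (f^n z) / 2)] is bounded by some [B], for all [n], on a square without basin points,
    so at some point of it all its directional derivatives are at most [K |eta|], with [K] depending
    only on [B] and the square. But turning [f^n z] about [0] changes the cotangent at a rate at
    least [1/2] and costs only a displacement of [z] of order [kappa^-n], [kappa > 1] the
    expansion factor. Finally, where the iterates are normal, a limit function vanishes at the basin
    points; these being dense, some iterate moves the centre of the neighbourhood close to [0], and
    the centre itself belongs to the basin. *)

Lemma exp_le (x y : R) : x <= y -> exp x <= exp y.
Proof.
  intros [Hlt | ->]; [left; apply exp_increasing, Hlt | apply Rle_refl].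
Qed.

Lemma sin_ge_cubic (x : R) : 0 <= x <= 4 -> x - x ^ 3 / 6 <= sin x.
Proof.
  intros Hx. destruct (pre_sin_bound x 0) as [Hlow _]; try lra.
  unfold sin_approx, sin_term in Hlow; simpl in Hlow. lra.
Qed.

Lemma cos_ge_quadratic (x : R) : -2 <= x <= 2 -> 1 - x ^ 2 / 2 <= cos x.
Proof.
  intros Hx. destruct (pre_cos_bound x 0) as [Hlow _]; try lra.
  unfold cos_approx, cos_term in Hlow; simpl in Hlow. lra.
Qed.

Lemma mult_sin_ge_0 (x : R) : Rabs x <= PI -> 0 <= x * sin x.
Proof.
  intros Hx. apply Rabs_le_between in Hx.
  destruct (Rle_dec 0 x).
  - apply Rmult_le_pos; [ | apply sin_ge_0]; lra.
  - rewrite <- Rmult_opp_opp, <- sin_neg.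
    apply Rmult_le_pos; [ | apply sin_ge_0]; lra.
Qed.

Lemma Rabs_mult_cos_minus_mult_sin_le (p x : R) : Rabs x <= 2 ->
  Rabs (x * cos x - p * sin x) <= Rabs x * (Rabs (p - 1) + x ^ 2 / 2).
Proof.
  assert (Hpos : forall y, 0 <= y <= 2 ->
    Rabs (y * cos y - p * sin y) <= y * (Rabs (p - 1) + y ^ 2 / 2)).
  { intros y Hy.
    assert (Hy3 : 0 <= y ^ 3) by (apply pow_le; lra).
    assert (Hcos := cos_ge_quadratic y ltac:(lra)).
    assert (Hcos1 := proj2 (COS_bound y)).
    assert (Hsin := sin_ge_cubic y ltac:(lra)).
    assert (Hsin0 : 0 <= sin y) by (apply sin_ge_0; assert (Hpi := PI2_3_2); lra).
    assert (Hsin1 : sin y <= y).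
    { destruct (proj1 Hy) as [Hy0 | <-]; [left; apply sin_lt_x, Hy0 | rewrite sin_0; lra]. }
    assert (Hdiff : Rabs (y * cos y - sin y) <= y ^ 3 / 2).
    { apply Rabs_le.
      assert (y * (1 - y ^ 2 / 2) <= y * cos y) by (apply Rmult_le_compat_l; lra).
      assert (y * cos y <= y * 1) by (apply Rmult_le_compat_l; lra). lra. }
    replace (y * cos y - p * sin y) with (y * cos y - sin y + - ((p - 1) * sin y)) by ring.
    eapply Rle_trans; [apply Rabs_triang | ].
    rewrite Rabs_Ropp, Rabs_mult, (Rabs_pos_eq (sin y)) by easy.
    assert (Rabs (p - 1) * sin y <= Rabs (p - 1) * y)
      by (apply Rmult_le_compat_l; [apply Rabs_pos | easy]).
    lra. }
  intros Hx. apply Rabs_le_between in Hx.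
  destruct (Rle_dec 0 x).
  - rewrite (Rabs_pos_eq x) by easy. apply Hpos; lra.
  - specialize (Hpos (- x) ltac:(lra)). rewrite cos_neg, sin_neg in Hpos.
    rewrite (Rabs_left x) by lra.
    replace (x * cos x - p * sin x) with (- (- x * cos x - p * - sin x)) by ring.
    rewrite Rabs_Ropp. replace (x ^ 2) with ((- x) ^ 2) by ring. exact Hpos.
Qed.

Lemma Cmod_le_Rabs_re_plus_Rabs_im (z : C) : Cmod z <= Rabs (Re z) + Rabs (Im z).
Proof.
  assert (Hsq := Cmod2_alt z). assert (Hz := Cmod_ge_0 z).
  assert (Hre := Rabs_pos (Re z)). assert (Him := Rabs_pos (Im z)).
  rewrite <- (pow2_abs (Re z)), <- (pow2_abs (Im z)) in Hsq. nra.
Qed.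

Lemma Rabs_im_le_Cmod (z : C) : Rabs (Im z) <= Cmod z.
Proof. eapply Rle_trans; [apply Rmax_r | apply Rmax_Cmod]. Qed.

Lemma re_le_Cmod_between (z : C) : - Cmod z <= Re z <= Cmod z.
Proof. apply Rabs_le_between, re_le_Cmod. Qed.

Lemma Cmod_Cexp (z : C) : Cmod (Cexp z) = exp (Re z).
Proof.
  apply Rsqr_inj; [apply Cmod_ge_0 | left; apply exp_pos | ].
  rewrite !Rsqr_pow2, Cmod2_alt. unfold Cexp, Re, Im; cbn [fst snd].
  assert (Hsc := sin2_cos2 (snd z)). rewrite !Rsqr_pow2 in Hsc.
  transitivity (exp (fst z) ^ 2 * (sin (snd z) ^ 2 + cos (snd z) ^ 2)); [ring | ].
  rewrite Hsc. ring.
Qed.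


Lemma nat_seq_dichotomy (m : nat -> nat) :
  (exists (j : nat) (phi : nat -> nat),
    (forall k, (phi k < phi (S k))%nat) /\ forall k, m (phi k) = j) \/
  filterlim m eventually eventually.
Proof.
  destruct (classic (exists j, forall N, exists k, (N <= k)%nat /\ m k = j)) as [[j Hj] | Hnone].
  - left. exists j. destruct (functional_choice _ Hj) as [next Hnext].
    exists (fun k => Nat.iter k (fun i => next (S i)) (next O)). split.
    + intros k. apply (Hnext (S _)).
    + intros [ | k]; apply Hnext.
  - right. intros P [J HJ]. change (eventually (fun k => P (m k))).
    apply (filter_imp (fun k => (J <= m k)%nat)); [intros k; apply HJ | ].
    clear P HJ. induction J as [ | J [N IH]]; [exists O; intros; lia | ].
    destruct (not_all_ex_not _ _ (not_ex_all_not _ _ Hnone J)) as [N' HN'].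
    exists (max N N'). intros k Hk.
    assert (m k <> J) by (intros E; apply HN'; exists k; split; [lia | exact E]).
    specialize (IH k ltac:(lia)). lia.
Qed.

Lemma eventually_pow_mult_lt (q M eps : R) : 0 <= q < 1 -> 0 < eps ->
  eventually (fun n => q ^ n * M < eps).
Proof.
  intros Hq Heps.
  assert (Hlim : is_lim_seq (fun n => q ^ n * M) 0).
  { replace (Finite 0) with (Rbar_mult 0 M) by (simpl; f_equal; ring).
    apply is_lim_seq_scal_r, is_lim_seq_geom. rewrite Rabs_pos_eq; lra. }
  apply (Hlim (fun x => x < eps)). exact (open_lt eps 0 Heps).
Qed.

(** * Continuity and maxima on squares *)

Lemma continuous_Re (z : C) : continuous Re z.
Proof. destruct z. apply continuous_fst. Qed.

Lemma continuous_Im (z : C) : continuous Im z.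
Proof. destruct z. apply continuous_snd. Qed.

Lemma continuous_Re_Im {U : UniformSpace} (g : U -> C) (u : U) :
  continuous (fun v => Re (g v)) u -> continuous (fun v => Im (g v)) u -> continuous g u.
Proof.
  intros Hre Him.
  apply (continuous_ext (fun v => (Re (g v), Im (g v)) : C)).
  { intros v. symmetry. apply surjective_pairing. }
  apply (continuous_comp_2 (fun v => Re (g v)) (fun v => Im (g v)) (fun a b => (a, b)));
    [exact Hre | exact Him | ].
  apply continuous_ext with (2 := continuous_id _). intros [x y]. reflexivity.
Qed.

Lemma continuous_div {U : UniformSpace} (f g : U -> R) (u : U) :
  continuous f u -> continuous g u -> g u <> 0 -> continuous (fun v => f v / g v) u.
Proof.
  intros Hf Hg Hgu. apply (continuous_mult (K := R_AbsRing) f (fun v => / g v)); [exact Hf | ].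
  apply (continuous_comp g Rinv); [exact Hg | apply continuous_Rinv, Hgu].
Qed.

Ltac solve_continuous := lazymatch goal with
  | |- continuous (fun w => Re w) _ => apply continuous_Re
  | |- continuous (fun w => Im w) _ => apply continuous_Im
  | |- continuous (fun w => @?f w + @?g w) _ =>
      apply (continuous_plus (V := R_NormedModule) f g); solve_continuous
  | |- continuous (fun w => @?f w - @?g w) _ =>
      apply (continuous_minus (V := R_NormedModule) f g); solve_continuous
  | |- continuous (fun w => - @?f w) _ =>
      apply (continuous_opp (V := R_NormedModule) f); solve_continuous
  | |- continuous (fun w => @?f w * @?g w) _ =>
      apply (continuous_mult (K := R_AbsRing) f g); solve_continuous
  | |- continuous (fun w => @?f w / @?g w) _ =>
      apply (continuous_div f g); [solve_continuous | solve_continuous | ]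
  | |- continuous (fun w => @?f w ^ ?n) _ =>
      apply (continuous_comp f (fun x => x ^ n));
        [solve_continuous | apply (ex_derive_continuous (fun x => x ^ n)); auto_derive; exact I]
  | |- continuous (fun w => exp (@?f w)) _ =>
      apply (continuous_comp f exp); [solve_continuous | apply continuous_exp]
  | |- continuous (fun w => cos (@?f w)) _ =>
      apply (continuous_comp f cos); [solve_continuous | apply continuous_cos]
  | |- continuous (fun w => sin (@?f w)) _ =>
      apply (continuous_comp f sin); [solve_continuous | apply continuous_sin]
  | |- _ => apply continuous_const
  end.

Lemma continuous_Cmod (z : C) : continuous Cmod z.
Proof.
  apply (continuous_comp (fun w : C => Re w ^ 2 + Im w ^ 2) sqrt);
    [solve_continuous | apply continuous_sqrt].
Qed.

Lemma locally_lt (f : C -> R) (z : C) (r : R) : continuous f z -> f z < r ->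
  locally z (fun w => f w < r).
Proof. intros Hf Hr. exact (Hf _ (open_lt r (f z) Hr)). Qed.

Lemma locally_gt (f : C -> R) (z : C) (r : R) : continuous f z -> r < f z ->
  locally z (fun w => r < f w).
Proof. intros Hf Hr. exact (Hf _ (open_gt r (f z) Hr)). Qed.

Definition square (z0 : C) (r : R) (z : C) : Prop :=
  Rabs (Re z - Re z0) <= r /\ Rabs (Im z - Im z0) <= r.

Lemma square_center (z0 : C) (r : R) : 0 <= r -> square z0 r z0.
Proof. intros Hr. split; rewrite Rminus_diag, Rabs_R0; exact Hr. Qed.

Lemma locally_square (z0 : C) (P : C -> Prop) : locally z0 P ->
  exists r, 0 < r /\ forall z, square z0 r z -> P z.
Proof.
  intros [d Hd]. assert (Hpos := cond_pos d). exists (d / 2). split; [lra | ].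
  intros z [Hre Him]. apply Hd. split.
  - apply Rle_lt_trans with (1 := Hre). lra.
  - apply Rle_lt_trans with (1 := Him). lra.
Qed.

Lemma lt_on_square_gap (g : C -> R) (z0 : C) (r s : R) :
  (forall z, square z0 r z -> continuous g z) -> (forall z, square z0 r z -> g z < s) ->
  exists d, 0 < d /\ forall z, square z0 r z -> g z <= s - d.
Proof.
  intros Hcont Hlt.
  assert (Hlocal : forall z, exists d : posreal, square z0 r z -> forall w : C,
    Rabs (Re w - Re z) < d -> Rabs (Im w - Im z) < d -> g w <= s - d).
  { intros z. destruct (classic (square z0 r z)) as [Hz | Hz];
      [ | exists (mkposreal 1 Rlt_0_1); easy].
    specialize (Hlt z Hz).
    destruct (locally_lt g z ((g z + s) / 2) (Hcont z Hz)) as [d Hd]; [lra | ].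
    assert (Hmin : 0 < Rmin d ((s - g z) / 2)) by (apply Rmin_pos; [apply cond_pos | lra]).
    exists (mkposreal _ Hmin). intros _ w Hre Him. simpl in *.
    apply Rmin_Rgt in Hre, Him.
    assert (Hgw := Hd w (conj (proj1 Hre) (proj1 Him))).
    assert (Hr := Rmin_r d ((s - g z) / 2)). lra. }
  destruct (functional_choice _ Hlocal) as [delta Hdelta].
  destruct (compactness_value_2d (Re z0 - r) (Re z0 + r) (Im z0 - r) (Im z0 + r)
    (fun x y => delta (x, y))) as [d Hcover].
  exists d. split; [apply cond_pos | ]. intros z [Hre Him].
  apply Rabs_le_between in Hre, Him.
  destruct (NNPP _ (Hcover (Re z) (Im z) ltac:(lra) ltac:(lra)))
    as [x [y [Hx [Hy [Hzx [Hzy Hd]]]]]].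
  assert (Hxy : square z0 r (x, y)) by (split; simpl; apply Rabs_le; lra).
  assert (Hgz := Hdelta _ Hxy z Hzx Hzy). lra.
Qed.

Lemma max_on_square (g : C -> R) (z0 : C) (r : R) : 0 <= r ->
  (forall z, square z0 r z -> continuous g z) ->
  exists z, square z0 r z /\ forall w, square z0 r w -> g w <= g z.
Proof.
  intros Hr Hcont.
  destruct (completeness (fun v => exists z, square z0 r z /\ atan (g z) = v)) as [s [Hub Hlub]].
  { exists (PI / 2). intros v [z [_ <-]]. left. apply atan_bound. }
  { exists (atan (g z0)), z0. split; [apply square_center, Hr | reflexivity]. }
  apply NNPP. intros Hnone.
  assert (Hlt : forall z, square z0 r z -> atan (g z) < s).
  { intros z Hz. apply Rnot_le_lt. intros Hsz. apply Hnone. exists z. split; [exact Hz | ].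
    intros w Hw. apply Rnot_lt_le. intros Hzw. apply atan_increasing in Hzw.
    assert (Hle := Hub _ (ex_intro _ w (conj Hw eq_refl))). lra. }
  destruct (lt_on_square_gap (fun z => atan (g z)) z0 r s) as [d [Hd Hgap]]; [ | exact Hlt | ].
  { intros z Hz. apply (continuous_comp g atan); [apply Hcont, Hz | apply continuous_atan]. }
  assert (s <= s - d) by (apply Hlub; intros v [z [Hz <-]]; apply Hgap, Hz).
  lra.
Qed.

Definition line (z eta : C) (t : R) : C := (z + RtoC t * eta)%C.

Lemma re_line (z eta : C) (t : R) : Re (line z eta t) = Re z + t * Re eta.
Proof. unfold line. rewrite re_plus, re_scal_l. reflexivity. Qed.

Lemma im_line (z eta : C) (t : R) : Im (line z eta t) = Im z + t * Im eta.
Proof. unfold line. rewrite im_plus, im_scal_l. reflexivity. Qed.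

Lemma line_0 (z eta : C) : line z eta 0 = z.
Proof. unfold line. ring. Qed.

Lemma locally_line_square (z0 z eta : C) (r : R) :
  Rabs (Re z - Re z0) < r -> Rabs (Im z - Im z0) < r ->
  locally 0 (fun t => square z0 r (line z eta t)).
Proof.
  assert (Hnear : forall x x0 e, Rabs (x - x0) < r ->
    locally 0 (fun t => Rabs (x + t * e - x0) < r)).
  { intros x x0 e Hx.
    assert (Hcont : continuous (fun t => Rabs (x + t * e - x0)) 0).
    { apply continuous_Rabs_comp, (ex_derive_continuous (fun t => x + t * e - x0)).
      auto_derive. exact I. }
    apply (Hcont (fun u => u < r)), open_lt. rewrite Rmult_0_l, Rplus_0_r. exact Hx. }
  intros Hre Him.
  generalize (filter_and _ _ (Hnear _ _ (Re eta) Hre) (Hnear _ _ (Im eta) Him)).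
  apply filter_imp. intros t [Htre Htim]. unfold square. rewrite re_line, im_line. lra.
Qed.

Lemma interior_max_slope (g : C -> R) (z0 z eta : C) (r l : R) :
  Rabs (Re z - Re z0) < r -> Rabs (Im z - Im z0) < r ->
  (forall w, square z0 r w -> g w <= g z) ->
  is_derive (fun t => g (line z eta t)) 0 l -> l = 0.
Proof.
  intros Hre Him Hmax Hl. apply is_derive_Reals in Hl.
  destruct (locally_line_square z0 z eta r Hre Him) as [e He]. assert (Hpos := cond_pos e).
  apply (deriv_maximum (fun t => g (line z eta t)) (- e) e 0 (exist _ l Hl)); [lra | lra | ].
  intros t Ht1 Ht2. rewrite line_0. apply Hmax, He.
  change (Rabs (t - 0) < e). rewrite Rminus_0_r. apply Rabs_lt_between. lra.
Qed.

Lemma square_inner_le (z0 z eta : C) (r : R) : square z0 r z ->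
  Rabs ((Re z - Re z0) * Re eta + (Im z - Im z0) * Im eta) <= 2 * r * Cmod eta.
Proof.
  intros [Hre Him]. eapply Rle_trans; [apply Rabs_triang | ]. rewrite !Rabs_mult.
  assert (Rabs (Re z - Re z0) * Rabs (Re eta) <= r * Cmod eta)
    by (apply Rmult_le_compat; try apply Rabs_pos; [exact Hre | apply re_le_Cmod]).
  assert (Rabs (Im z - Im z0) * Rabs (Im eta) <= r * Cmod eta)
    by (apply Rmult_le_compat; try apply Rabs_pos; [exact Him | apply Rabs_im_le_Cmod]).
  lra.
Qed.

Definition sq_dist (z0 z : C) : R := (Re z - Re z0) ^ 2 + (Im z - Im z0) ^ 2.

Lemma penalised_max_interior (g : C -> R) (z0 : C) (r B L : R) : 0 < r -> 2 * B < L * r ^ 2 ->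
  (forall z, square z0 r z -> continuous g z) ->
  (forall z, square z0 r z -> Rabs (g z) <= B) ->
  exists z, (Rabs (Re z - Re z0) < r /\ Rabs (Im z - Im z0) < r) /\
    forall w, square z0 r w -> g w - L * sq_dist z0 w <= g z - L * sq_dist z0 z.
Proof.
  intros Hr HL Hcont HB.
  assert (Hz0 := square_center z0 r (Rlt_le _ _ Hr)).
  destruct (max_on_square (fun z => g z - L * sq_dist z0 z) z0 r) as [z [Hz Hmax]]; [lra | | ].
  { intros z Hz. apply (continuous_minus (V := R_NormedModule) g); [apply Hcont, Hz | ].
    unfold sq_dist. solve_continuous. }
  exists z. split; [ | exact Hmax].
  assert (Hdist : sq_dist z0 z < r ^ 2).
  { assert (Hle := Hmax z0 Hz0).
    assert (Hgz := HB z Hz). assert (Hg0 := HB z0 Hz0). apply Rabs_le_between in Hgz, Hg0.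
    replace (sq_dist z0 z0) with 0 in Hle by (unfold sq_dist; ring).
    assert (HL0 : 0 < L) by (assert (Hr2 := pow_lt r 2 Hr); nra).
    apply Rmult_lt_reg_l with L; lra. }
  unfold sq_dist in Hdist.
  assert (Hre := pow2_ge_0 (Re z - Re z0)). assert (Him := pow2_ge_0 (Im z - Im z0)).
  rewrite <- (Rabs_pos_eq r) by lra. split; apply Rsqr_lt_abs_0; rewrite !Rsqr_pow2; lra.
Qed.

(* At an interior maximum of [g - L |z - z0|^2] the slope of [g] is that of the penalty. *)
Lemma exists_small_slope (g : C -> R) (z0 : C) (r B : R) : 0 < r ->
  (forall z, square z0 r z -> continuous g z) ->
  (forall z, square z0 r z -> Rabs (g z) <= B) ->
  exists z, square z0 r z /\ forall eta l, is_derive (fun t => g (line z eta t)) 0 l ->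
    Rabs l <= 4 * (2 * B + 1) / r * Cmod eta.
Proof.
  intros Hr Hcont HB.
  assert (HB0 := HB z0 (square_center z0 r (Rlt_le _ _ Hr))).
  assert (Hg0 := Rabs_pos (g z0)).
  set (L := (2 * B + 1) / r ^ 2).
  assert (Hr2 : 0 < r ^ 2) by (apply pow_lt, Hr).
  assert (HL0 : 0 < L) by (apply Rdiv_lt_0_compat; lra).
  assert (HL : L * r ^ 2 = 2 * B + 1) by (unfold L; field; lra).
  destruct (penalised_max_interior g z0 r B L Hr ltac:(lra) Hcont HB) as [z [[Hre Him] Hmax]].
  assert (Hz : square z0 r z) by (split; lra).
  exists z. split; [exact Hz | ]. intros eta l Hl.
  set (inner := (Re z - Re z0) * Re eta + (Im z - Im z0) * Im eta).
  assert (Hslope : l - L * (2 * inner) = 0).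
  { apply (interior_max_slope (fun w => g w - L * sq_dist z0 w) z0 z eta r); try assumption.
    apply (is_derive_minus (V := R_NormedModule) (fun t => g (line z eta t))); [exact Hl | ].
    apply is_derive_ext with (fun t => L *
      ((Re z + t * Re eta - Re z0) ^ 2 + (Im z + t * Im eta - Im z0) ^ 2)).
    { intros t. unfold sq_dist. rewrite re_line, im_line. reflexivity. }
    unfold inner. auto_derive; [exact I | ring]. }
  replace l with (2 * L * inner) by lra.
  rewrite Rabs_mult, (Rabs_pos_eq (2 * L)) by lra.
  replace (4 * (2 * B + 1) / r * Cmod eta) with (2 * L * (2 * r * Cmod eta))
    by (unfold L; field; lra).
  apply Rmult_le_compat_l; [lra | apply square_inner_le, Hz].
Qed.

(** * Curves and the cotangent of half the argument *)

Definition is_logderive (g : R -> C) (t : R) (c : C) : Prop :=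
  is_derive (fun s => Re (g s)) t (Re (g t * c)%C) /\
  is_derive (fun s => Im (g s)) t (Im (g t * c)%C).

Lemma is_logderive_ext (g h : R -> C) (t : R) (c : C) : (forall s, g s = h s) ->
  is_logderive g t c -> is_logderive h t c.
Proof.
  intros Hgh [Hre Him]. unfold is_logderive. rewrite <- Hgh. split.
  - apply is_derive_ext with (2 := Hre). intros s. rewrite Hgh. reflexivity.
  - apply is_derive_ext with (2 := Him). intros s. rewrite Hgh. reflexivity.
Qed.

Lemma is_logderive_line (z c : C) : is_logderive (line z (z * c)) 0 c.
Proof.
  assert (Haffine : forall x e : R, is_derive (fun t => x + t * e) 0 e).
  { intros x e. auto_derive; [exact I | ring]. }
  unfold is_logderive. rewrite line_0. split.
  - apply is_derive_ext with (2 := Haffine (Re z) _). intros t. symmetry. apply re_line.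
  - apply is_derive_ext with (2 := Haffine (Im z) _). intros t. symmetry. apply im_line.
Qed.

Definition cot_half_arg (w : C) : R := Im w / (Cmod w - Re w).

Lemma continuous_cot_half_arg (w : C) : Re w < Cmod w -> continuous cot_half_arg w.
Proof.
  intros Hw. apply (continuous_div Im (fun w => Cmod w - Re w)); [apply continuous_Im | | lra].
  apply (continuous_minus (V := R_NormedModule) Cmod);
    [apply continuous_Cmod | apply continuous_Re].
Qed.

Lemma cot_half_arg_bound (M : R) (w : C) : 0 <= M -> w <> RtoC 0 -> Re w <= M ->
  (0 <= Re w -> 1 <= Rabs (Im w)) -> Re w < Cmod w /\ Rabs (cot_half_arg w) <= 2 * M + 1.
Proof.
  intros HM Hw Hre Him. apply Cmod_gt_0 in Hw.
  assert (Hsq := Cmod2_alt w). rewrite <- (pow2_abs (Im w)) in Hsq.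
  assert (Hle := Rabs_im_le_Cmod w). assert (Htri := Cmod_le_Rabs_re_plus_Rabs_im w).
  assert (Hy := Rabs_pos (Im w)).
  assert (Hbound : Re w < Cmod w /\ Rabs (Im w) <= (2 * M + 1) * (Cmod w - Re w)).
  { destruct (Rle_dec 0 (Re w)) as [Hre0 | Hre0]; [ | split; [lra | nra]].
    specialize (Him Hre0). rewrite Rabs_pos_eq in Htri by exact Hre0.
    set (y := Rabs (Im w)) in *. set (x := Re w) in *. set (m := Cmod w) in *.
    assert (Hmx : x < m) by nra. split; [exact Hmx | ].
    assert (Hfactor : y * y = (m - x) * (m + x)) by (ring_simplify; lra).
    assert (Hsum : m + x <= (2 * M + 1) * y) by nra.
    apply Rmult_le_reg_r with y; [lra | ]. rewrite Hfactor. nra. }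
  destruct Hbound as [Hpos Hcot]. split; [exact Hpos | ].
  unfold cot_half_arg, Rdiv. rewrite Rabs_mult, Rabs_inv, (Rabs_pos_eq (Cmod w - Re w)) by lra.
  apply Rle_div_l; lra.
Qed.

Lemma is_derive_cot_half_arg_coord (X Y : R -> R) (t : R) :
  is_derive X t (- Y t) -> is_derive Y t (X t) -> X t < sqrt (X t * X t + Y t * Y t) ->
  is_derive (fun s => Y s / (sqrt (X s * X s + Y s * Y s) - X s)) t
    (- (sqrt (X t * X t + Y t * Y t) / (sqrt (X t * X t + Y t * Y t) - X t))).
Proof.
  intros HX HY Hlt.
  assert (EX : Derive (fun s : R => X s) t = - Y t) by exact (is_derive_unique _ _ _ HX).
  assert (EY : Derive (fun s : R => Y s) t = X t) by exact (is_derive_unique _ _ _ HY).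
  assert (Hnonneg : 0 <= X t * X t + Y t * Y t) by nra.
  assert (Hsq := sqrt_sqrt _ Hnonneg). assert (Hm := sqrt_pos (X t * X t + Y t * Y t)).
  assert (Hpos : 0 < X t * X t + Y t * Y t) by (destruct (Rle_dec 0 (X t)); nra).
  auto_derive.
  - repeat split; try (eexists; eassumption); lra.
  - rewrite EX, EY.
    set (m := sqrt (X t * X t + Y t * Y t)) in *.
    transitivity (X t / (m - X t) - Y t * Y t / (m - X t) ^ 2); [field; nra | ].
    replace (Y t * Y t) with ((m - X t) * (m + X t)) by lra.
    field. lra.
Qed.

(* [is_logderive g t Ci] says that [g] turns about [0] with unit angular speed. *)
Lemma is_derive_cot_half_arg (g : R -> C) (t : R) : is_logderive g t Ci ->
  Re (g t) < Cmod (g t) ->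
  is_derive (fun s => cot_half_arg (g s)) t (- (Cmod (g t) / (Cmod (g t) - Re (g t)))).
Proof.
  intros [Hre Him] Hlt.
  rewrite re_mult_Ci in Hre.
  replace (Im (g t * Ci)%C) with (Re (g t)) in Him by (rewrite im_mult; simpl; ring).
  assert (Hmod : forall w, Cmod w = sqrt (Re w * Re w + Im w * Im w))
    by (intros w; unfold Cmod, Re, Im; f_equal; ring).
  apply is_derive_ext with
    (fun s => Im (g s) / (sqrt (Re (g s) * Re (g s) + Im (g s) * Im (g s)) - Re (g s))).
  { intros s. unfold cot_half_arg. rewrite Hmod. reflexivity. }
  rewrite Hmod in *. exact (is_derive_cot_half_arg_coord _ _ t Hre Him Hlt).
Qed.

(** * The chordal metric *)

Lemma Cmod_minus_sym (z w : C) : Cmod (z - w) = Cmod (w - z).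
Proof. rewrite <- Cmod_opp. f_equal. ring. Qed.

Lemma chord_sym (a b : Chat) : chord a b = chord b a.
Proof.
  destruct a as [z | ], b as [w | ]; try reflexivity. simpl.
  rewrite Cmod_minus_sym, (Rmult_comm (1 + _)). reflexivity.
Qed.

Lemma chord_refl (a : Chat) : chord a a = 0.
Proof.
  destruct a as [z | ]; [ | reflexivity]. simpl.
  replace (z - z)%C with (RtoC 0) by ring. rewrite Cmod_0. unfold Rdiv. ring.
Qed.

(* Norm of the homogeneous coordinates [(z, 1)]. *)
Definition hnorm (z : C) : R := sqrt (1 + Cmod z ^ 2).

Lemma hnorm_sq (z : C) : hnorm z ^ 2 = 1 + Cmod z ^ 2.
Proof. apply pow2_sqrt. assert (Hz := pow2_ge_0 (Cmod z)). lra. Qed.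

Lemma hnorm_ge (z : C) : 1 <= hnorm z /\ Cmod z <= hnorm z.
Proof.
  assert (Hsq := hnorm_sq z). assert (Hnonneg : 0 <= hnorm z) by apply sqrt_pos.
  assert (Hz := Cmod_ge_0 z). split; nra.
Qed.

Lemma hnorm_le_plus (z w : C) : hnorm w <= hnorm z + Cmod (z - w).
Proof.
  rewrite Cmod_minus_sym.
  assert (Hz := hnorm_sq z). assert (Hw := hnorm_sq w). destruct (hnorm_ge z) as [Hz1 Hmz].
  assert (Htri := Cmod_triangle z (w - z)). replace (z + (w - z))%C with w in Htri by ring.
  assert (Hd := Cmod_ge_0 (w - z)). assert (Hw0 := Cmod_ge_0 w).
  apply Rsqr_incr_0_var; [ | lra]. rewrite !Rsqr_pow2. nra.
Qed.

Lemma chord_finite (z w : C) : chord (Some z) (Some w) = 2 * Cmod (z - w) / (hnorm z * hnorm w).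
Proof.
  unfold chord, hnorm. assert (Hz := pow2_ge_0 (Cmod z)). assert (Hw := pow2_ge_0 (Cmod w)).
  rewrite sqrt_mult by lra. reflexivity.
Qed.

Lemma chord_le (z w : C) : chord (Some z) (Some w) <= 2 * Cmod (z - w).
Proof.
  rewrite chord_finite. assert (Hd := Cmod_ge_0 (z - w)).
  destruct (hnorm_ge z) as [Hz _]. destruct (hnorm_ge w) as [Hw _].
  apply Rle_div_l; [nra | ]. assert (1 <= hnorm z * hnorm w) by nra. nra.
Qed.

(* Cauchy-Schwarz for the homogeneous coordinates of [z] and [w]. *)
Lemma Cmod_1_plus_conj_mult_le (z w : C) : Cmod (1 + Cconj z * w) <= hnorm z * hnorm w.
Proof.
  destruct (hnorm_ge z) as [Hz _]. destruct (hnorm_ge w) as [Hw _].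
  apply Rsqr_incr_0_var; [ | nra]. rewrite !Rsqr_pow2, Rpow_mult_distr, !hnorm_sq, !Cmod2_alt.
  rewrite re_plus, im_plus, re_mult, im_mult, re_conj, im_conj, re_RtoC.
  change (Im 1) with 0.
  assert (Hre := pow2_ge_0 (Re z - Re w)). assert (Him := pow2_ge_0 (Im z - Im w)).
  lra.
Qed.

Lemma Cmod_minus_hnorm_le (z u w : C) :
  Cmod (z - w) * hnorm u <= Cmod (z - u) * hnorm w + Cmod (u - w) * hnorm z.
Proof.
  destruct (hnorm_ge u) as [Hu _].
  apply Rmult_le_reg_r with (hnorm u); [lra | ].
  assert (E : ((z - w) * (1 + Cconj u * u))%C
    = ((z - u) * (1 + Cconj u * w) + (u - w) * (1 + Cconj u * z))%C) by ring.
  assert (Enorm : (1 + Cconj u * u)%C = RtoC (hnorm u ^ 2)).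
  { rewrite hnorm_sq, Cmult_comm, RtoC_plus, Cmod2_conj. reflexivity. }
  assert (Htri := Cmod_triangle ((z - u) * (1 + Cconj u * w)) ((u - w) * (1 + Cconj u * z))).
  rewrite <- E, Enorm, !Cmod_mult, Cmod_R, Rabs_pos_eq in Htri by apply pow2_ge_0.
  assert (Hcs1 := Rmult_le_compat_l _ _ _ (Cmod_ge_0 (z - u)) (Cmod_1_plus_conj_mult_le u w)).
  assert (Hcs2 := Rmult_le_compat_l _ _ _ (Cmod_ge_0 (u - w)) (Cmod_1_plus_conj_mult_le u z)).
  lra.
Qed.

Lemma hnorm_pos (z : C) : 0 < hnorm z.
Proof. destruct (hnorm_ge z). lra. Qed.

Lemma chord_infinity (z : C) : chord (Some z) None = 2 / hnorm z.
Proof. reflexivity. Qed.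

Lemma chord_finite_scaled (z w : C) :
  chord (Some z) (Some w) * (hnorm z * hnorm w) = 2 * Cmod (z - w).
Proof.
  rewrite chord_finite. assert (Hz := hnorm_pos z). assert (Hw := hnorm_pos w). field. lra.
Qed.

Lemma chord_infinity_scaled (z : C) : chord (Some z) None * hnorm z = 2.
Proof. rewrite chord_infinity. assert (Hz := hnorm_pos z). field. lra. Qed.

Lemma chord_ge_0 (a b : Chat) : 0 <= chord a b.
Proof.
  assert (Hinf : forall z, 0 <= chord (Some z) None).
  { intros z. apply Rdiv_le_0_compat; [lra | apply hnorm_pos]. }
  destruct a as [z | ], b as [w | ];
    [ | apply Hinf | rewrite chord_sym; apply Hinf | apply Rle_refl].
  rewrite chord_finite. assert (Hd := Cmod_ge_0 (z - w)).
  apply Rdiv_le_0_compat; [lra | apply Rmult_lt_0_compat; apply hnorm_pos].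
Qed.

Lemma chord_triangle (a b c : Chat) : chord a c <= chord a b + chord b c.
Proof.
  assert (Hto_inf : forall z u,
    chord (Some z) None <= chord (Some z) (Some u) + chord (Some u) None).
  { intros z u. assert (Hz := hnorm_pos z). assert (Hu := hnorm_pos u).
    apply Rmult_le_reg_r with (hnorm z * hnorm u); [apply Rmult_lt_0_compat; assumption | ].
    assert (Hnorm := hnorm_le_plus z u). assert (Hzu := chord_finite_scaled z u).
    assert (Ez := chord_infinity_scaled z). assert (Eu := chord_infinity_scaled u).
    replace ((_ + _) * _) with (2 * Cmod (z - u) + 2 * hnorm z) by (rewrite <- Hzu, <- Eu; ring).
    replace (_ * _) with (2 * hnorm u) by (rewrite <- Ez; ring). lra. }
  destruct a as [z | ], b as [u | ], c as [w | ];
    try (rewrite (chord_refl None); lra); try apply Hto_inf.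
  - assert (Hz := hnorm_pos z). assert (Hu := hnorm_pos u). assert (Hw := hnorm_pos w).
    apply Rmult_le_reg_r with (hnorm z * hnorm w * hnorm u);
      [repeat apply Rmult_lt_0_compat; assumption | ].
    assert (Hptolemy := Cmod_minus_hnorm_le z u w).
    assert (Hzw := chord_finite_scaled z w). assert (Hzu := chord_finite_scaled z u).
    assert (Huw := chord_finite_scaled u w).
    replace ((_ + _) * _) with (2 * Cmod (z - u) * hnorm w + 2 * Cmod (u - w) * hnorm z)
      by (rewrite <- Hzu, <- Huw; ring).
    rewrite <- Rmult_assoc, Hzw. lra.
  - assert (Hz := hnorm_pos z). assert (Hw := hnorm_pos w).
    apply Rmult_le_reg_r with (hnorm z * hnorm w); [apply Rmult_lt_0_compat; assumption | ].
    rewrite chord_finite_scaled, (chord_sym None).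
    assert (Ez := chord_infinity_scaled z). assert (Ew := chord_infinity_scaled w).
    replace ((_ + _) * _) with (2 * hnorm w + 2 * hnorm z)
      by (rewrite <- Ez at 1; rewrite <- Ew; ring).
    assert (Htri := Cmod_triangle z (- w)). rewrite Cmod_opp in Htri.
    destruct (hnorm_ge z) as [_ Hz1]. destruct (hnorm_ge w) as [_ Hw1].
    change (z + - w)%C with (z - w)%C in Htri. lra.
  - rewrite (chord_sym None (Some w)), (chord_sym None (Some u)), (chord_sym (Some u) (Some w)),
      Rplus_comm.
    apply Hto_inf.
  - rewrite chord_refl. assert (Hleft := chord_ge_0 None (Some u)).
    assert (Hright := chord_ge_0 (Some u) None). lra.
Qed.

Lemma chord_near (z : C) (v : Chat) (r : R) : chord (Some z) v < r -> r * hnorm z <= 1 ->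
  exists u, v = Some u /\ Cmod (z - u) <= r * hnorm z ^ 2.
Proof.
  intros Hv Hr. assert (Hz := hnorm_pos z).
  destruct v as [u | ].
  - exists u. split; [reflexivity | ].
    assert (Hu := hnorm_pos u). assert (Hnorm := hnorm_le_plus z u).
    assert (Hd := Cmod_ge_0 (z - u)). assert (Hzu := chord_finite_scaled z u).
    assert (Hscaled : chord (Some z) (Some u) * (hnorm z * hnorm u) <= r * (hnorm z * hnorm u)).
    { apply Rmult_le_compat_r; [left; apply Rmult_lt_0_compat; assumption | lra]. }
    assert (Hr0 : 0 <= r) by (assert (Hchord := chord_ge_0 (Some z) (Some u)); lra).
    assert (r * hnorm z * hnorm u <= r * hnorm z * (hnorm z + Cmod (z - u)))
      by (apply Rmult_le_compat_l; [apply Rmult_le_pos; lra | exact Hnorm]).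
    assert (r * hnorm z * Cmod (z - u) <= 1 * Cmod (z - u)) by (apply Rmult_le_compat_r; lra).
    lra.
  - exfalso. assert (E := chord_infinity_scaled z).
    assert (chord (Some z) None * hnorm z <= r * hnorm z) by (apply Rmult_le_compat_r; lra). lra.
Qed.

Lemma locally_chord_ball (z : C) (r : R) : 0 < r ->
  locally z (fun w => chord (Some z) (Some w) < r).
Proof.
  intros Hr.
  assert (Hcont : continuous (fun w : C => Cmod (w - z)) z).
  { apply (continuous_comp (fun w : C => (w - z)%C) Cmod); [ | apply continuous_Cmod].
    apply (continuous_minus (V := C_R_NormedModule));
      [apply continuous_id | apply continuous_const]. }
  assert (Hlocal : locally z (fun w => Cmod (w - z) < r / 2)).
  { apply locally_lt; [exact Hcont | ].
    replace (z - z)%C with (RtoC 0) by ring. rewrite Cmod_0. lra. }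
  assert (Hle : forall w : C, Cmod (w - z) < r / 2 -> chord (Some z) (Some w) < r).
  { intros w Hw. rewrite chord_sym. assert (Hle := chord_le w z). lra. }
  exact (filter_imp _ _ Hle Hlocal).
Qed.

Lemma chord_ball_of_locally (z : C) (P : C -> Prop) : locally z P ->
  exists r, 0 < r /\ forall v, chord (Some z) v < r -> exists u, v = Some u /\ P u.
Proof.
  intros [d Hd]. assert (Hpos := cond_pos d). assert (Hz := hnorm_pos z).
  assert (Hz2 : 0 < hnorm z ^ 2) by (apply pow_lt, Hz).
  exists (Rmin (/ hnorm z) (d / (2 * hnorm z ^ 2))). split.
  { apply Rmin_pos; [apply Rinv_0_lt_compat, Hz | apply Rdiv_lt_0_compat; lra]. }
  set (r := Rmin _ _). intros v Hv.
  assert (Hr1 : r <= / hnorm z) by apply Rmin_l.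
  assert (Hr2 : r <= d / (2 * hnorm z ^ 2)) by apply Rmin_r.
  destruct (chord_near z v r Hv) as [u [-> Hu]].
  { rewrite <- (Rinv_l (hnorm z)) by lra. apply Rmult_le_compat_r; lra. }
  exists u. split; [reflexivity | ]. apply Hd.
  assert (Hud : Cmod (u - z) < d).
  { apply (Rmult_le_compat_r (hnorm z ^ 2)) in Hr2; [ | lra].
    rewrite Cmod_minus_sym.
    replace (d / (2 * hnorm z ^ 2) * hnorm z ^ 2) with (d / 2) in Hr2 by (field; lra). lra. }
  apply C_NormedModule_mixin_compat1, Hud.
Qed.

Lemma chord_ball_open (a b : Chat) (r : R) : chord_ball a r b ->
  exists r', 0 < r' /\ forall v, chord b v < r' -> chord_ball a r v.
Proof.
  unfold chord_ball. intros Hb. exists (r - chord a b). split; [lra | ].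
  intros v Hv. assert (Htri := chord_triangle a b v). lra.
Qed.

(** * The map and its logarithmic derivative *)

Definition zeta (lam : R) (z : C) : C := (RtoC lam * (z / (z + 1)) * Cexp (- z))%C.

Definition sq_dist_pole (z : C) : R := (Re z + 1) ^ 2 + Im z ^ 2.

(* [z f'(z) / f(z)] for [f = zeta lam]. *)
Definition logder (z : C) : C := (/ (z + 1) - z)%C.

Lemma sq_dist_pole_Cmod (z : C) : sq_dist_pole z = Cmod (z + 1) ^ 2.
Proof. rewrite Cmod2_alt. destruct z as [x y]. unfold sq_dist_pole; simpl. ring. Qed.

Lemma Cplus_1_neq_0 (z : C) : z <> RtoC (-1) -> (z + 1)%C <> 0%C.
Proof.
  intros Hz E. apply Hz. replace z with ((z + 1) - 1)%C by ring.
  rewrite E. unfold Cminus, Cplus, Copp, RtoC; simpl. f_equal; ring.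
Qed.

Lemma sq_dist_pole_pos (z : C) : z <> RtoC (-1) -> 0 < sq_dist_pole z.
Proof.
  intros Hz. rewrite sq_dist_pole_Cmod. apply pow_lt, Cmod_gt_0, Cplus_1_neq_0, Hz.
Qed.

Lemma re_neq_pole (z : C) : Re z <> -1 -> z <> RtoC (-1).
Proof. intros Hre ->. apply Hre. reflexivity. Qed.

Lemma re_zeta (lam : R) (z : C) : Re (zeta lam z) =
  lam * exp (- Re z) / sq_dist_pole z *
    ((Re z ^ 2 + Re z + Im z ^ 2) * cos (Im z) + Im z * sin (Im z)).
Proof.
  destruct z as [x y].
  unfold zeta, sq_dist_pole, Cdiv, Cinv, Cmult, Cplus, Cexp, Copp, RtoC, Re, Im; cbn [fst snd].
  rewrite cos_neg, sin_neg, Rplus_0_r. unfold Rdiv. ring.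
Qed.

Lemma im_zeta (lam : R) (z : C) : Im (zeta lam z) =
  lam * exp (- Re z) / sq_dist_pole z *
    (Im z * cos (Im z) - (Re z ^ 2 + Re z + Im z ^ 2) * sin (Im z)).
Proof.
  destruct z as [x y].
  unfold zeta, sq_dist_pole, Cdiv, Cinv, Cmult, Cplus, Cexp, Copp, RtoC, Re, Im; cbn [fst snd].
  rewrite cos_neg, sin_neg, Rplus_0_r. unfold Rdiv. ring.
Qed.

Lemma logder_eq (z : C) : logder z =
  ((Re z + 1) / sq_dist_pole z - Re z, - Im z / sq_dist_pole z - Im z).
Proof.
  destruct z as [x y].
  unfold logder, sq_dist_pole, Cminus, Cinv, Cplus, Copp, RtoC, Re, Im; cbn [fst snd].
  rewrite Rplus_0_r. reflexivity.
Qed.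

(* The right-hand side is [|z^2 + z - 1|^2]. *)
Lemma Cmod_logder_sq (z : C) : z <> RtoC (-1) -> Cmod (logder z) ^ 2 * sq_dist_pole z =
  (Re z ^ 2 + Re z - 1 - Im z ^ 2) ^ 2 + (Im z * (2 * Re z + 1)) ^ 2.
Proof.
  intros Hz. assert (Hpos := sq_dist_pole_pos z Hz).
  rewrite Cmod2_alt, logder_eq. unfold sq_dist_pole, Re, Im in *; cbn [fst snd]. field. lra.
Qed.

Lemma Cmod_zeta (lam : R) (z : C) : 0 <= lam -> z <> RtoC (-1) ->
  Cmod (zeta lam z) = lam * (Cmod z / Cmod (z + 1)) * exp (- Re z).
Proof.
  intros Hlam Hz. unfold zeta.
  rewrite !Cmod_mult, Cmod_Cexp, Cmod_R, Rabs_pos_eq, Cmod_div;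
    [reflexivity | apply Cplus_1_neq_0, Hz | exact Hlam].
Qed.

Lemma Cmod_plus_1_ge (z : C) : 0 <= Re z -> Cmod z <= Cmod (z + 1) /\ 1 <= Cmod (z + 1).
Proof.
  intros Hre. assert (Hz := Cmod2_alt z). assert (Hz1 := sq_dist_pole_Cmod z).
  unfold sq_dist_pole in Hz1. assert (Him := pow2_ge_0 (Im z)).
  split; apply Rsqr_incr_0_var; rewrite ?Rsqr_pow2; try apply Cmod_ge_0; nra.
Qed.

Lemma Cmod_zeta_right (lam : R) (z : C) : 0 <= lam -> 0 <= Re z ->
  Cmod (zeta lam z) <= lam * Cmod z /\ Cmod (zeta lam z) <= lam * exp (- Re z).
Proof.
  intros Hlam Hre. rewrite Cmod_zeta; [ | exact Hlam | apply re_neq_pole; lra].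
  destruct (Cmod_plus_1_ge z Hre) as [Hz Hz1].
  assert (Hz0 := Cmod_ge_0 z). assert (He := exp_pos (- Re z)).
  assert (He1 : exp (- Re z) <= 1) by (rewrite <- exp_0; apply exp_le; lra).
  assert (Hq0 : 0 <= Cmod z / Cmod (z + 1)) by (apply Rdiv_le_0_compat; lra).
  assert (Hq1 : Cmod z / Cmod (z + 1) <= 1) by (apply Rle_div_l; lra).
  assert (Hqz : Cmod z / Cmod (z + 1) <= Cmod z) by (apply Rle_div_l; nra).
  rewrite !Rmult_assoc. split; apply Rmult_le_compat_l; nra.
Qed.

Lemma continuous_zeta (lam : R) (z : C) : z <> RtoC (-1) -> continuous (zeta lam) z.
Proof.
  intros Hz. assert (Hpos := sq_dist_pole_pos z Hz).
  apply continuous_Re_Im.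
  - apply continuous_ext with (1 := fun w => eq_sym (re_zeta lam w)).
    unfold sq_dist_pole in *. solve_continuous. lra.
  - apply continuous_ext with (1 := fun w => eq_sym (im_zeta lam w)).
    unfold sq_dist_pole in *. solve_continuous. lra.
Qed.

Lemma is_logderive_zeta_coord (lam : R) (X Y : R -> R) (t : R) (c : C) :
  (X t, Y t) <> RtoC (-1) -> is_logderive (fun s => (X s, Y s)) t c ->
  is_logderive (fun s => zeta lam (X s, Y s)) t (c * logder (X t, Y t))%C.
Proof.
  intros Hz [HX HY]. assert (Hpos := sq_dist_pole_pos _ Hz).
  destruct c as [c1 c2].
  change (is_derive X t (X t * c1 - Y t * c2)) in HX.
  change (is_derive Y t (X t * c2 + Y t * c1)) in HY.
  assert (EX : Derive (fun s : R => X s) t = X t * c1 - Y t * c2)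
    by exact (is_derive_unique _ _ _ HX).
  assert (EY : Derive (fun s : R => Y s) t = X t * c2 + Y t * c1)
    by exact (is_derive_unique _ _ _ HY).
  unfold is_logderive. rewrite !re_mult, !im_mult, !re_mult, logder_eq, re_zeta, im_zeta.
  split; (eapply is_derive_ext; [intros s; symmetry; (apply re_zeta || apply im_zeta) | ]);
    unfold sq_dist_pole, Re, Im in *; cbn [fst snd] in *; auto_derive.
  1, 3: simpl in Hpos; repeat split; try (eexists; eassumption); lra.
  all: rewrite EX, EY; field; lra.
Qed.

Lemma is_logderive_zeta (lam : R) (g : R -> C) (t : R) (c : C) : g t <> RtoC (-1) ->
  is_logderive g t c -> is_logderive (fun s => zeta lam (g s)) t (c * logder (g t))%C.
Proof.
  intros Hz Hg.
  assert (Epair : forall s, g s = (Re (g s), Im (g s))) by (intros; apply surjective_pairing).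
  apply is_logderive_ext with (fun s => zeta lam (Re (g s), Im (g s)));
    [intros s; rewrite <- Epair; reflexivity | ].
  rewrite (Epair t) in Hz |- *.
  apply (is_logderive_zeta_coord lam (fun s => Re (g s)) (fun s => Im (g s))); [exact Hz | ].
  exact (is_logderive_ext _ _ t c Epair Hg).
Qed.

(** * The invariant half-strip and expansion outside it *)

Definition strip (z : C) : Prop := 0 <= Re z /\ Rabs (Im z) <= PI / 2.

Lemma not_strip_im (z : C) : ~ strip z -> 0 <= Re z -> 3 / 2 < Rabs (Im z).
Proof.
  intros Hz Hre. assert (Hpi := PI2_3_2).
  apply Rnot_le_lt. intros Him. apply Hz. split; lra.
Qed.

Lemma strip_zeta (lam : R) (z : C) : 0 < lam < 1 -> strip z -> strip (zeta lam z).
Proof.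
  intros Hlam [Hre Him]. assert (Hpi := PI2_3_2). split.
  - rewrite re_zeta. apply Rmult_le_pos.
    + apply Rdiv_le_0_compat; [apply Rmult_le_pos; [lra | left; apply exp_pos] | ].
      apply sq_dist_pole_pos, re_neq_pole. lra.
    + assert (Hsin := mult_sin_ge_0 (Im z) ltac:(lra)).
      apply Rabs_le_between in Him. assert (Hcos := cos_ge_0 (Im z) ltac:(lra) ltac:(lra)).
      assert (0 <= Re z ^ 2 + Re z + Im z ^ 2) by nra. nra.
  - destruct (Cmod_zeta_right lam z) as [_ Hle]; [lra | easy | ].
    assert (He : exp (- Re z) <= 1) by (rewrite <- exp_0; apply exp_le; lra).
    assert (Hex := exp_pos (- Re z)). assert (Hi := Rabs_im_le_Cmod (zeta lam z)). nra.
Qed.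

(* The expanding metric is [weight z |dz| / |z|]. *)
Definition weight (z : C) : R := 1 + Rmax 0 (Re z) / 2.

Lemma weight_right (z : C) : 0 <= Re z -> weight z = 1 + Re z / 2.
Proof. intros Hz. unfold weight. rewrite Rmax_right by exact Hz. reflexivity. Qed.

Lemma weight_left (z : C) : Re z <= 0 -> weight z = 1.
Proof. intros Hz. unfold weight. rewrite Rmax_left by exact Hz. lra. Qed.

Lemma weight_ge_1 (z : C) : 1 <= weight z.
Proof. unfold weight. assert (Hmax := Rmax_l 0 (Re z)). lra. Qed.

Lemma Cmod_logder_right (z : C) : 0 <= Re z -> 3 / 2 <= Rabs (Im z) ->
  101 / 100 * (1 + Re z / 2) ^ 2 <= Cmod (logder z) ^ 2.
Proof.
  intros Hre Him.
  assert (Hne : z <> RtoC (-1)) by (apply re_neq_pole; lra).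
  apply Rmult_le_reg_r with (sq_dist_pole z); [apply sq_dist_pole_pos, Hne | ].
  rewrite Cmod_logder_sq by exact Hne. unfold sq_dist_pole.
  assert (Him2 : 9 / 4 <= Im z ^ 2) by (rewrite <- pow2_abs; nra).
  set (x := Re z) in *. set (s := Im z ^ 2) in *.
  replace ((Im z * (2 * x + 1)) ^ 2) with (s * (2 * x + 1) ^ 2) by (unfold s; ring).
  assert (Hx3 : 0 <= x ^ 3) by (apply pow_le, Hre).
  assert (Hsx : 0 <= (s - 9 / 4) * x ^ 2) by (apply Rmult_le_pos; nra).
  assert (Hsx1 : 0 <= (s - 9 / 4) * x) by (apply Rmult_le_pos; lra).
  assert (Hs2 : 0 <= (s - 9 / 4) * s) by (apply Rmult_le_pos; lra).
  assert (Hx2 := pow2_ge_0 (x ^ 2 - x)). assert (Hx1 := pow2_ge_0 (x - 1)).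
  nra.
Qed.

Lemma Cmod_logder_middle (d : R) (z : C) : 0 < d <= 1 -> d <= Cmod z -> z <> RtoC (-1) ->
  -5 / 4 <= Re z <= 0 -> 1 + d ^ 2 / 100 <= Cmod (logder z) ^ 2.
Proof.
  intros Hd Hz Hne Hre.
  apply Rmult_le_reg_r with (sq_dist_pole z); [apply sq_dist_pole_pos, Hne | ].
  rewrite Cmod_logder_sq by exact Hne. unfold sq_dist_pole.
  assert (Hmod := Cmod2_alt z). assert (Hd2 : d ^ 2 <= Cmod z ^ 2) by (apply pow_incr; lra).
  rewrite Hmod in Hd2.
  set (x := Re z) in *. set (s := Im z ^ 2) in *.
  replace ((Im z * (2 * x + 1)) ^ 2) with (s * (2 * x + 1) ^ 2) by (unfold s; ring).
  assert (Hs : 0 <= s) by apply pow2_ge_0.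
  assert (Hgap : 1 / 4 * (x ^ 2 + s) <=
    (x ^ 2 + x - 1 - s) ^ 2 + s * (2 * x + 1) ^ 2 - ((x + 1) ^ 2 + s)).
  { replace ((x ^ 2 + x - 1 - s) ^ 2 + s * (2 * x + 1) ^ 2 - ((x + 1) ^ 2 + s))
      with (- x * ((x + 2) * (2 - x ^ 2)) + (s ^ 2 + s * (2 * x ^ 2 + 2 * x + 2))) by ring.
    assert (5 / 16 <= (x + 2) * (2 - x ^ 2)).
    { apply Rle_trans with (3 / 4 * (7 / 16)); [lra | apply Rmult_le_compat; nra]. }
    assert (- x * (5 / 16) <= - x * ((x + 2) * (2 - x ^ 2))) by (apply Rmult_le_compat_l; lra).
    nra. }
  assert (Hpole : (x + 1) ^ 2 <= 1) by nra.
  assert (d ^ 2 / 100 * ((x + 1) ^ 2 + s) <= d ^ 2 / 100 * (1 + s))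
    by (apply Rmult_le_compat_l; nra).
  assert (d ^ 2 * s <= 1 * s) by (apply Rmult_le_compat_r; nra).
  nra.
Qed.

Section NearCriticalPoint.

Variables (k : R) (z : C).
Hypothesis re_z : Re z <= -5 / 4.
Hypothesis Cmod_logder_z : Cmod (logder z) <= k.

Lemma logder_bound_nonneg : 0 <= k.
Proof. eapply Rle_trans; [apply Cmod_ge_0 | exact Cmod_logder_z]. Qed.

Let a : R := - 1 - Re z.
Let s : R := Im z ^ 2.

Lemma left_logder_bound :
  (a ^ 2 + a - 1 - s) ^ 2 + s * (1 + 2 * a) ^ 2 <= k ^ 2 * (a ^ 2 + s).
Proof.
  assert (Hne : z <> RtoC (-1)) by (apply re_neq_pole; lra).
  assert (Hle : Cmod (logder z) ^ 2 * sq_dist_pole z <= k ^ 2 * sq_dist_pole z).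
  { apply Rmult_le_compat_r; [left; apply sq_dist_pole_pos, Hne | ].
    apply pow_incr. split; [apply Cmod_ge_0 | exact Cmod_logder_z]. }
  rewrite (Cmod_logder_sq z Hne) in Hle. unfold sq_dist_pole in Hle. unfold s, a. lra.
Qed.

Lemma left_re_le : k <= 3 / 2 -> Rabs (a ^ 2 + a - 1 - s) <= k * a.
Proof.
  intros Hk. assert (Hbound := left_logder_bound). assert (Hk0 := logder_bound_nonneg).
  assert (Ha : 1 / 4 <= a) by (unfold a; lra). assert (Hs : 0 <= s) by apply pow2_ge_0.
  clearbody a s.
  rewrite <- (Rabs_pos_eq (k * a)) by (apply Rmult_le_pos; lra).
  apply Rsqr_le_abs_0. rewrite !Rsqr_pow2.
  assert (0 <= s * ((1 + 2 * a) ^ 2 - k ^ 2)) by (apply Rmult_le_pos; nra).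
  lra.
Qed.

Lemma left_im_le : s * (1 + 2 * a) ^ 2 <= k ^ 2 * (a ^ 2 + s).
Proof.
  assert (Hbound := left_logder_bound). assert (Hre := pow2_ge_0 (a ^ 2 + a - 1 - s)). lra.
Qed.

Lemma near_critical_point : k <= 11 / 10 -> 2 / 5 <= a <= 6 / 5 /\ s <= 3 / 16.
Proof.
  intros Hk. assert (Hre := left_re_le ltac:(lra)). assert (Him := left_im_le).
  apply Rabs_le_between in Hre.
  assert (Hk0 := logder_bound_nonneg).
  assert (Hk2 : k ^ 2 <= 121 / 100) by nra.
  assert (Ha : 1 / 4 <= a) by (unfold a; lra). assert (Hs : 0 <= s) by apply pow2_ge_0.
  clearbody a s.
  assert (Hka : k * a <= 11 / 10 * a) by (apply Rmult_le_compat_r; lra).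
  assert (Hsk : s * (4 * a + 316 / 100) <= 121 / 100 * a).
  { apply Rmult_le_reg_r with a; [lra | ].
    assert (k ^ 2 * (a ^ 2 + s) <= 121 / 100 * (a ^ 2 + s)) by (apply Rmult_le_compat_r; nra).
    assert (0 <= s * (a - 1 / 4)) by (apply Rmult_le_pos; lra). lra. }
  assert (Hs1 : s <= 31 / 100) by (apply Rmult_le_reg_r with (4 * a + 316 / 100); lra).
  assert (Ha1 : 2 / 5 <= a) by (apply Rnot_lt_le; intros Hlt; nra).
  assert (Ha2 : a <= 6 / 5) by (apply Rnot_lt_le; intros Hlt; nra).
  split; [lra | apply Rmult_le_reg_r with (4 * a + 316 / 100); lra].
Qed.

Lemma near_critical_point_half : k <= 1 / 2 -> 1 / 2 <= a <= 1 /\ s <= 1 / 16.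
Proof.
  intros Hk. assert (Hre := left_re_le ltac:(lra)). assert (Him := left_im_le).
  apply Rabs_le_between in Hre.
  assert (Hk0 := logder_bound_nonneg).
  assert (Hk2 : k ^ 2 <= 1 / 4) by nra.
  assert (Ha : 1 / 4 <= a) by (unfold a; lra). assert (Hs : 0 <= s) by apply pow2_ge_0.
  clearbody a s.
  assert (Hka : k * a <= 1 / 2 * a) by (apply Rmult_le_compat_r; lra).
  assert (Hs1 : s <= 1 / 16).
  { assert (k ^ 2 * (a ^ 2 + s) <= 1 / 4 * (a ^ 2 + s)) by (apply Rmult_le_compat_r; nra).
    assert (0 < a ^ 2) by (apply pow_lt; lra).
    apply Rmult_le_reg_r with (4 * a ^ 2); nra. }
  split; [nra | exact Hs1].
Qed.

(* [z (conj z + 1) = p + i Im z], which has the argument of [z / (z + 1)]. *)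
Let p : R := Re z ^ 2 + Re z + Im z ^ 2.

Lemma zeta_near_critical_point_sector (lam : R) : 0 <= lam -> k <= 11 / 10 ->
  2 * Rabs (Im (zeta lam z)) <= Re (zeta lam z).
Proof.
  intros Hlam Hk. destruct (near_critical_point Hk) as [Ha Hs].
  assert (Hf : 0 <= lam * exp (- Re z) / sq_dist_pole z).
  { apply Rdiv_le_0_compat; [apply Rmult_le_pos; [lra | left; apply exp_pos] | ].
    apply sq_dist_pole_pos, re_neq_pole; lra. }
  rewrite re_zeta, im_zeta, Rabs_mult, (Rabs_pos_eq _ Hf).
  rewrite <- Rmult_assoc, (Rmult_comm 2), Rmult_assoc. apply Rmult_le_compat_l; [exact Hf | ].
  fold p.
  assert (Hy : Rabs (Im z) <= 7 / 16).
  { unfold s in Hs. rewrite <- pow2_abs in Hs. assert (Hnonneg := Rabs_pos (Im z)). nra. }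
  assert (Him := Rabs_mult_cos_minus_mult_sin_le p (Im z) ltac:(lra)). fold s in Him.
  assert (Hpi := PI2_3_2).
  assert (Hsin := mult_sin_ge_0 (Im z) ltac:(lra)).
  assert (Hcos : 29 / 32 <= cos (Im z)).
  { assert (Hlow := cos_ge_quadratic (Im z)). apply Rabs_le_between in Hy. fold s in Hlow. lra. }
  assert (Hs0 : 0 <= s) by apply pow2_ge_0.
  assert (Hp : 14 / 25 <= p <= 3).
  { replace p with (a ^ 2 + a + s) by (unfold p, a, s; ring). clearbody a s. nra. }
  assert (Hpc : p * (29 / 32) <= p * cos (Im z)) by (apply Rmult_le_compat_l; lra).
  assert (Hq : Rabs (Im z) * (Rabs (p - 1) + s / 2) <= 7 / 16 * (Rabs (p - 1) + s / 2)).
  { apply Rmult_le_compat_r; [assert (Hnonneg := Rabs_pos (p - 1)); lra | exact Hy]. }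
  assert (Hp1 : Rabs (p - 1) <= 29 / 28 * p - 3 / 32) by (apply Rabs_le; lra).
  lra.
Qed.

(* AM-GM on the two squares of [left_logder_bound]. *)
Lemma left_im_factor_le : k <= 1 / 2 ->
  Rabs (Im z) * (Rabs (p - 1) + s / 2) <= sq_dist_pole z / 9.
Proof.
  intros Hk. assert (Hbound := left_logder_bound).
  assert (Hk0 := logder_bound_nonneg).
  destruct (near_critical_point_half Hk) as [Ha Hs].
  replace (sq_dist_pole z) with (a ^ 2 + s) by (unfold sq_dist_pole, a, s; ring).
  replace (p - 1) with ((a ^ 2 + a - 1 - s) + 2 * s) by (unfold p, a, s; ring).
  assert (Es : s = Rabs (Im z) ^ 2) by (unfold s; symmetry; apply pow2_abs).
  assert (Hy := Rabs_pos (Im z)).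
  set (y := Rabs (Im z)) in *. set (u := a ^ 2 + a - 1 - s) in *. clearbody a s y u. subst s.
  assert (Hu := Rabs_pos u). rewrite <- pow2_abs in Hbound. set (v := Rabs u) in *.
  assert (Hsum : v ^ 2 + (y * (1 + 2 * a)) ^ 2 <= (a ^ 2 + y ^ 2) / 4).
  { assert (k ^ 2 * (a ^ 2 + y ^ 2) <= 1 / 4 * (a ^ 2 + y ^ 2)) by (apply Rmult_le_compat_r; nra).
    lra. }
  assert (Hy2 : y * 2 <= y * (1 + 2 * a)) by (apply Rmult_le_compat_l; lra).
  assert (Hsq : (y * 2) ^ 2 <= (y * (1 + 2 * a)) ^ 2) by (apply pow_incr; lra).
  assert (Hv2 := pow2_ge_0 v). assert (Hamgm := pow2_ge_0 (v - y * (1 + 2 * a))).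
  assert (Huy : v * (y * 2) <= v * (y * (1 + 2 * a))) by (apply Rmult_le_compat_l; lra).
  assert (Hy4 : y <= 1 / 4) by nra.
  assert (Htri : Rabs (u + 2 * y ^ 2) <= v + 2 * y ^ 2).
  { eapply Rle_trans; [apply Rabs_triang | ].
    rewrite (Rabs_pos_eq (2 * y ^ 2)); [unfold v; lra | nra]. }
  apply Rle_trans with (y * (v + 5 / 2 * y ^ 2)); [apply Rmult_le_compat_l; lra | ].
  assert (Hy0 := pow2_ge_0 y). assert (Ha0 := pow2_ge_0 a).
  assert (y * y ^ 2 <= 1 / 4 * y ^ 2) by (apply Rmult_le_compat_r; lra).
  lra.
Qed.

Lemma Rabs_im_zeta_near_critical_point_le (lam : R) : 0 <= lam <= 1 -> k <= 1 / 2 ->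
  Rabs (Im (zeta lam z)) <= 1.
Proof.
  intros Hlam Hk. destruct (near_critical_point_half Hk) as [Ha Hs].
  assert (Hpos : 0 < sq_dist_pole z) by (apply sq_dist_pole_pos, re_neq_pole; lra).
  assert (Him : Rabs (Im z * cos (Im z) - p * sin (Im z)) <= sq_dist_pole z / 9).
  { eapply Rle_trans; [apply Rabs_mult_cos_minus_mult_sin_le | exact (left_im_factor_le Hk)].
    unfold s in Hs. rewrite <- pow2_abs in Hs. assert (Hnonneg := Rabs_pos (Im z)). nra. }
  assert (Hexp : exp (- Re z) <= 9).
  { apply Rle_trans with (exp (1 + 1)); [apply exp_le; unfold a in Ha; lra | ].
    rewrite exp_plus. assert (He3 := exp_le_3). assert (He1 := exp_pos 1). nra. }
  assert (He0 := exp_pos (- Re z)).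
  rewrite im_zeta, Rabs_mult, Rabs_pos_eq
    by (apply Rdiv_le_0_compat; [apply Rmult_le_pos | ]; lra).
  fold p. apply Rle_trans with (lam * exp (- Re z) / sq_dist_pole z * (sq_dist_pole z / 9)).
  - apply Rmult_le_compat_l; [apply Rdiv_le_0_compat; [apply Rmult_le_pos | ]; lra | exact Him].
  - replace (lam * exp (- Re z) / sq_dist_pole z * (sq_dist_pole z / 9))
      with (lam * (exp (- Re z) / 9)) by (field; lra). nra.
Qed.

End NearCriticalPoint.

(** * The basin and uniform expansion outside it *)

(* At the pole [-1] the division returns a junk value, so [orbit] is meaningful only for points
   that avoid the pole. *)
Definition orbit (lam : R) (n : nat) (z : C) : C := Nat.iter n (zeta lam) z.

Definition avoids_pole (lam : R) (z : C) : Prop := forall n, orbit lam n z <> RtoC (-1).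

(* Chosen so that [(1 - trap_radius lam) ^ 2 >= (1 + lam) / 2]. *)
Definition trap_radius (lam : R) : R := (1 - lam) / 4.

Definition in_basin (lam : R) (z : C) : Prop :=
  avoids_pole lam z /\ exists n, Cmod (orbit lam n z) < trap_radius lam.

Definition rate (lam : R) : R := sqrt (1 + trap_radius lam ^ 2 / 100).

Fixpoint logder_orbit (lam : R) (n : nat) (z : C) : C :=
  match n with
  | O => RtoC 1
  | S m => (logder_orbit lam m z * logder (orbit lam m z))%C
  end.

Lemma orbit_add (lam : R) (m n : nat) (z : C) :
  orbit lam (m + n) z = orbit lam m (orbit lam n z).
Proof. apply Nat.iter_add. Qed.

Section Dynamics.

Variable lam : R.
Hypothesis lam_bounds : 0 < lam < 1.

Lemma trap_radius_bounds : 0 < trap_radius lam <= 1 / 4.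
Proof. unfold trap_radius; lra. Qed.

Lemma rate_bounds : 1 < rate lam <= 11 / 10 /\ rate lam ^ 2 = 1 + trap_radius lam ^ 2 / 100.
Proof.
  assert (Hd := trap_radius_bounds).
  assert (Hsq : rate lam ^ 2 = 1 + trap_radius lam ^ 2 / 100) by (apply pow2_sqrt; nra).
  assert (Hnonneg : 0 <= rate lam) by apply sqrt_pos.
  split; [nra | exact Hsq].
Qed.

Lemma weighted_expansion (z : C) : z <> RtoC (-1) -> trap_radius lam <= Cmod z ->
  ~ strip z -> ~ strip (zeta lam z) ->
  rate lam * weight z <= Cmod (logder z) * weight (zeta lam z).
Proof.
  intros Hne Hz Hs Hfs.
  assert (Hd := trap_radius_bounds). destruct rate_bounds as [Hrate Hrate2].
  assert (Hf := weight_ge_1 (zeta lam z)). assert (Hq := Cmod_ge_0 (logder z)).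
  assert (Hexpand : rate lam * weight z <= Cmod (logder z) ->
    rate lam * weight z <= Cmod (logder z) * weight (zeta lam z)) by nra.
  destruct (Rle_dec 0 (Re z)) as [Hre | Hre].
  - apply Hexpand. rewrite weight_right by exact Hre.
    assert (Hright := Cmod_logder_right z Hre (Rlt_le _ _ (not_strip_im z Hs Hre))).
    apply Rsqr_incr_0_var; [ | exact Hq]. rewrite !Rsqr_pow2, Rpow_mult_distr, Hrate2.
    apply Rle_trans with (2 := Hright), Rmult_le_compat_r; [apply pow2_ge_0 | nra].
  - rewrite (weight_left z) in * by lra.
    destruct (Rle_dec (-5 / 4) (Re z)) as [Hre' | Hre'].
    + apply Hexpand. rewrite Rmult_1_r.
      apply Rsqr_incr_0_var; [ | exact Hq]. rewrite !Rsqr_pow2, Hrate2.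
      apply Cmod_logder_middle; (assumption || lra).
    + destruct (Rle_dec (Cmod (logder z)) (11 / 10)) as [Hsmall | Hlarge]; [ | apply Hexpand; lra].
      assert (Hsec := zeta_near_critical_point_sector _ z ltac:(lra) Hsmall lam
        ltac:(lra) ltac:(lra)).
      assert (Him := Rabs_pos (Im (zeta lam z))).
      apply not_strip_im in Hfs; [ | lra].
      destruct (Rle_dec (Cmod (logder z)) (1 / 2)) as [Htiny | Hhalf].
      * assert (Him1 := Rabs_im_zeta_near_critical_point_le _ z ltac:(lra) Htiny lam
          ltac:(lra) ltac:(lra)).
        lra.
      * rewrite weight_right by lra. nra.
Qed.

Lemma trapped_neq_pole (z : C) : Cmod z < trap_radius lam -> z <> RtoC (-1).
Proof.
  intros Hz ->. rewrite Cmod_R, Rabs_left in Hz by lra. assert (Hd := trap_radius_bounds). lra.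
Qed.

Definition trap_ratio : R := 2 * lam / (1 + lam).

Lemma trap_ratio_bounds : 0 < trap_ratio < 1.
Proof.
  unfold trap_ratio. split; [apply Rdiv_lt_0_compat; lra | apply Rlt_div_l; lra].
Qed.

Lemma zeta_trap (z : C) : Cmod z < trap_radius lam -> Cmod (zeta lam z) <= trap_ratio * Cmod z.
Proof.
  intros Hz. assert (Hd := trap_radius_bounds). assert (Hz0 := Cmod_ge_0 z).
  rewrite Cmod_zeta by (lra || apply trapped_neq_pole, Hz).
  set (d := trap_radius lam) in *.
  assert (Hpole : / Cmod (z + 1) <= / (1 - d)).
  { apply Rinv_le_contravar; [lra | ].
    assert (Htri := Cmod_triangle (z + 1) (- z)).
    replace (z + 1 + - z)%C with (RtoC 1) in Htri by ring. rewrite Cmod_opp, Cmod_1 in Htri. lra. }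
  assert (Hexp : exp (- Re z) <= / (1 - d)).
  { assert (Hre := re_le_Cmod_between z).
    rewrite exp_Ropp. apply Rinv_le_contravar; [lra | ].
    assert (Hexp := exp_ineq1_le (Re z)). lra. }
  assert (Hfactor : / Cmod (z + 1) * exp (- Re z) <= 2 / (1 + lam)).
  { apply Rle_trans with (/ (1 - d) * / (1 - d)).
    - apply Rmult_le_compat; [ | left; apply exp_pos | exact Hpole | exact Hexp].
      left. apply Rinv_0_lt_compat, Cmod_gt_0, Cplus_1_neq_0, trapped_neq_pole, Hz.
    - rewrite <- Rinv_mult. replace (2 / (1 + lam)) with (/ ((1 + lam) / 2)) by (field; lra).
      apply Rinv_le_contravar; unfold d, trap_radius; nra. }
  replace (lam * (Cmod z / Cmod (z + 1)) * exp (- Re z))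
    with (lam * Cmod z * (/ Cmod (z + 1) * exp (- Re z))) by (unfold Rdiv; ring).
  replace (trap_ratio * Cmod z) with (lam * Cmod z * (2 / (1 + lam)))
    by (unfold trap_ratio, Rdiv; ring).
  apply Rmult_le_compat_l; [apply Rmult_le_pos | ]; lra.
Qed.

Lemma orbit_trap (z : C) (n : nat) : Cmod z < trap_radius lam ->
  Cmod (orbit lam n z) <= trap_ratio ^ n * Cmod z /\ Cmod (orbit lam n z) < trap_radius lam.
Proof.
  intros Hz. assert (Hm := trap_ratio_bounds).
  induction n as [ | n [IHle IHlt]]; [simpl; lra | ].
  assert (Hstep := zeta_trap _ IHlt). assert (Hnonneg := Cmod_ge_0 (orbit lam n z)).
  change (orbit lam (S n) z) with (zeta lam (orbit lam n z)). simpl. split; nra.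
Qed.

Lemma eventually_trapped_orbit_lt (n : nat) (eps : R) : 0 < eps ->
  eventually (fun j => forall z,
    Cmod (orbit lam n z) < trap_radius lam -> Cmod (orbit lam j z) < eps).
Proof.
  intros Heps. assert (Hm := trap_ratio_bounds).
  destruct (eventually_pow_mult_lt trap_ratio (trap_radius lam) eps) as [N HN];
    [lra | exact Heps | ].
  exists (N + n)%nat. intros j Hj z Hz.
  replace j with ((j - n) + n)%nat by lia. rewrite orbit_add.
  apply Rle_lt_trans with (trap_ratio ^ (j - n) * trap_radius lam); [ | apply HN; lia].
  eapply Rle_trans; [apply orbit_trap, Hz | ].
  apply Rmult_le_compat_l; [apply pow_le; lra | lra].
Qed.

Lemma orbit_strip (n : nat) (z : C) : strip z ->
  strip (orbit lam n z) /\ Cmod (orbit lam n z) <= lam ^ n * Cmod z.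
Proof.
  intros Hz. induction n as [ | n [IHstrip IHle]]; [simpl; split; [exact Hz | lra] | ].
  change (orbit lam (S n) z) with (zeta lam (orbit lam n z)). split.
  - apply strip_zeta; assumption.
  - destruct (Cmod_zeta_right lam (orbit lam n z)) as [Hle _]; [lra | apply IHstrip | simpl; nra].
Qed.

Lemma in_basin_orbit (n : nat) (z : C) : avoids_pole lam z ->
  in_basin lam (orbit lam n z) -> in_basin lam z.
Proof.
  intros Hz [_ [m Hm]]. split; [exact Hz | ]. exists (m + n)%nat. rewrite orbit_add. exact Hm.
Qed.

Lemma strip_in_basin (z : C) : strip z -> in_basin lam z.
Proof.
  intros Hz. split.
  - intros n. apply re_neq_pole. assert (Hre := proj1 (proj1 (orbit_strip n z Hz))). lra.
  - destruct (eventually_pow_mult_lt lam (Cmod z) (trap_radius lam)) as [N HN];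
      [lra | apply trap_radius_bounds | ].
    exists N. eapply Rle_lt_trans; [apply orbit_strip, Hz | apply HN, Nat.le_refl].
Qed.

Lemma zeta_far_right (z : C) : / trap_radius lam < Re z -> Cmod (zeta lam z) < trap_radius lam.
Proof.
  intros Hre. assert (Hd := trap_radius_bounds).
  assert (Hinv : 0 < / trap_radius lam) by (apply Rinv_0_lt_compat; lra).
  destruct (Cmod_zeta_right lam z) as [_ Hle]; [lra | lra | ].
  assert (Hexp : exp (- Re z) < / (/ trap_radius lam)).
  { rewrite exp_Ropp. apply Rinv_lt_contravar.
    - apply Rmult_lt_0_compat; [exact Hinv | apply exp_pos].
    - assert (He := exp_ineq1_le (Re z)). lra. }
  rewrite Rinv_inv in Hexp. assert (He := exp_pos (- Re z)). nra.
Qed.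

Lemma orbit_outside_basin (z : C) (n : nat) : avoids_pole lam z -> ~ in_basin lam z ->
  trap_radius lam <= Cmod (orbit lam n z) /\ ~ strip (orbit lam n z) /\
  Re (orbit lam n z) <= / trap_radius lam.
Proof.
  intros Hz Hout. repeat split.
  - apply Rnot_lt_le. intros Htrapped. apply Hout. split; [exact Hz | exists n; exact Htrapped].
  - intros Hstrip. apply Hout, (in_basin_orbit n); [exact Hz | apply strip_in_basin, Hstrip].
  - apply Rnot_lt_le. intros Hright. apply Hout.
    split; [exact Hz | exists (S n); apply zeta_far_right, Hright].
Qed.

Lemma Cmod_logder_orbit_ge (z : C) (n : nat) : avoids_pole lam z -> ~ in_basin lam z ->
  rate lam ^ n <= Cmod (logder_orbit lam n z) * (1 + / trap_radius lam / 2).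
Proof.
  intros Hz Hout. destruct rate_bounds as [Hrate _].
  assert (Hweight : rate lam ^ n * weight z <=
    Cmod (logder_orbit lam n z) * weight (orbit lam n z)).
  { induction n as [ | n IH]; [simpl; rewrite Cmod_1; apply Rle_refl | ].
    destruct (orbit_outside_basin z n Hz Hout) as [Htrap [Hs _]].
    destruct (orbit_outside_basin z (S n) Hz Hout) as [_ [Hfs _]].
    assert (Hstep := weighted_expansion _ (Hz n) Htrap Hs Hfs).
    assert (HQ := Cmod_ge_0 (logder_orbit lam n z)).
    change (orbit lam (S n) z) with (zeta lam (orbit lam n z)).
    cbn [logder_orbit]. rewrite Cmod_mult. simpl pow.
    apply Rle_trans with (Cmod (logder_orbit lam n z) * (rate lam * weight (orbit lam n z)));
      [nra | ].
    rewrite Rmult_assoc. apply Rmult_le_compat_l; assumption. }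
  destruct (orbit_outside_basin z n Hz Hout) as [_ [_ Hre]].
  assert (Hinv := Rinv_0_lt_compat _ (proj1 trap_radius_bounds)).
  assert (Hw : weight (orbit lam n z) <= 1 + / trap_radius lam / 2).
  { assert (Hmax := Rmax_lub 0 _ _ (Rlt_le _ _ Hinv) Hre). unfold weight. lra. }
  assert (Hp : 0 < rate lam ^ n) by (apply pow_lt; lra).
  assert (Hwz := weight_ge_1 z). assert (HQ := Cmod_ge_0 (logder_orbit lam n z)).
  apply Rle_trans with (rate lam ^ n * weight z); [nra | ].
  eapply Rle_trans; [exact Hweight | apply Rmult_le_compat_l; assumption].
Qed.

Lemma is_logderive_orbit (n : nat) (g : R -> C) (t : R) (c : C) : avoids_pole lam (g t) ->
  is_logderive g t c ->
  is_logderive (fun s => orbit lam n (g s)) t (c * logder_orbit lam n (g t))%C.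
Proof.
  intros Hz Hg. induction n as [ | n IH].
  - simpl. rewrite Cmult_1_r. exact Hg.
  - cbn [logder_orbit]. rewrite Cmult_assoc.
    exact (is_logderive_zeta lam (fun s => orbit lam n (g s)) t _ (Hz n) IH).
Qed.

Lemma continuous_orbit (n : nat) (z : C) :
  (forall k, (k < n)%nat -> orbit lam k z <> RtoC (-1)) -> continuous (orbit lam n) z.
Proof.
  intros Hz. induction n as [ | n IH]; [apply continuous_id | ].
  apply (continuous_comp (orbit lam n) (zeta lam)).
  - apply IH. intros k Hk. apply Hz. lia.
  - apply continuous_zeta, Hz. lia.
Qed.

Lemma continuous_Cmod_orbit (n : nat) (z : C) : avoids_pole lam z ->
  continuous (fun w => Cmod (orbit lam n w)) z.
Proof.
  intros Hz. apply (continuous_comp (orbit lam n) Cmod); [ | apply continuous_Cmod].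
  apply continuous_orbit. intros k _. apply Hz.
Qed.

(* Turning [orbit lam n z] about [0] only displaces [z] by the order of [rate lam ^ (- n)]. *)
Lemma orbit_cot_slope (n : nat) (z : C) : avoids_pole lam z -> ~ in_basin lam z ->
  Re (orbit lam n z) < Cmod (orbit lam n z) ->
  exists eta l, is_derive (fun t => cot_half_arg (orbit lam n (line z eta t))) 0 l /\
    1 / 2 <= Rabs l /\ rate lam ^ n * Cmod eta <= Cmod z * (1 + / trap_radius lam / 2).
Proof.
  intros Hz Hout Hlt. assert (HQ := Cmod_logder_orbit_ge z n Hz Hout).
  set (Q := logder_orbit lam n z) in *. set (w := orbit lam n z) in *.
  assert (Hrate : 0 < rate lam ^ n) by (apply pow_lt; destruct rate_bounds; lra).
  assert (HQ0 : 0 < Cmod Q).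
  { destruct (Cmod_ge_0 Q) as [HQ0 | HQ0]; [exact HQ0 | ]. rewrite <- HQ0 in HQ. lra. }
  exists (z * (Ci / Q))%C, (- (Cmod w / (Cmod w - Re w))). split; [ | split].
  - assert (Hlog := is_logderive_orbit n (line z (z * (Ci / Q))%C) 0 (Ci / Q)%C).
    rewrite line_0 in Hlog. fold Q in Hlog.
    replace (Ci / Q * Q)%C with Ci in Hlog by (field; apply Cmod_gt_0, HQ0).
    assert (Hcot := is_derive_cot_half_arg _ 0 (Hlog Hz (is_logderive_line z _))).
    cbv beta in Hcot. rewrite line_0 in Hcot. exact (Hcot Hlt).
  - assert (Hre := re_le_Cmod_between w).
    rewrite Rabs_Ropp, Rabs_pos_eq by (apply Rdiv_le_0_compat; [apply Cmod_ge_0 | lra]).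
    apply (Rle_div_r (1 / 2)); lra.
  - rewrite Cmod_mult, Cmod_div, Cmod_Ci by apply Cmod_gt_0, HQ0.
    apply Rmult_le_reg_r with (Cmod Q); [exact HQ0 | ].
    replace (rate lam ^ n * (Cmod z * (1 / Cmod Q)) * Cmod Q) with (Cmod z * rate lam ^ n)
      by (field; lra).
    rewrite Rmult_assoc. apply Rmult_le_compat_l; [apply Cmod_ge_0 | lra].
Qed.

Lemma cot_half_arg_orbit_bound (n : nat) (z : C) : avoids_pole lam z -> ~ in_basin lam z ->
  Re (orbit lam n z) < Cmod (orbit lam n z) /\
  Rabs (cot_half_arg (orbit lam n z)) <= 2 * / trap_radius lam + 1.
Proof.
  intros Hz Hout. destruct (orbit_outside_basin z n Hz Hout) as [Htrap [Hs Hre]].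
  assert (Hd := trap_radius_bounds).
  apply cot_half_arg_bound;
    [left; apply Rinv_0_lt_compat; lra | apply Cmod_gt_0; lra | exact Hre | ].
  intros Hre0. apply not_strip_im in Hs; lra.
Qed.

Lemma Cmod_square_le (z0 z : C) (r : R) : square z0 r z -> Cmod z <= Cmod z0 + 2 * r.
Proof.
  intros [Hre Him].
  assert (Htri := Cmod_triangle z0 (z - z0)). replace (z0 + (z - z0))%C with z in Htri by ring.
  assert (Hsum := Cmod_le_Rabs_re_plus_Rabs_im (z - z0)).
  change (Re (z - z0)) with (Re z - Re z0) in Hsum.
  change (Im (z - z0)) with (Im z - Im z0) in Hsum.
  lra.
Qed.

Lemma basin_dense (z0 : C) : locally z0 (avoids_pole lam) ->
  ~ locally z0 (fun z => ~ in_basin lam z).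
Proof.
  intros Hdef Hout.
  destruct (locally_square z0 _ (filter_and _ _ Hdef Hout)) as [r [Hr Hsq]].
  assert (Hd := Rinv_0_lt_compat _ (proj1 trap_radius_bounds)).
  set (B := 2 * / trap_radius lam + 1). set (K := 4 * (2 * B + 1) / r).
  set (D := (Cmod z0 + 2 * r) * (1 + / trap_radius lam / 2)).
  assert (HK : 0 < K) by (apply Rdiv_lt_0_compat; unfold B; lra).
  destruct rate_bounds as [Hrate _].
  destruct (eventually_pow_mult_lt (/ rate lam) (K * D) (1 / 2)) as [n Hn]; [ | lra | ].
  { split; [left; apply Rinv_0_lt_compat; lra | ].
    rewrite <- Rinv_1. apply Rinv_lt_contravar; lra. }
  specialize (Hn n (Nat.le_refl n)).
  destruct (exists_small_slope (fun z => cot_half_arg (orbit lam n z)) z0 r B Hr)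
    as [z [Hz Hslope]].
  { intros z Hz. destruct (Hsq z Hz) as [Hzd Hzo].
    apply (continuous_comp (orbit lam n) cot_half_arg).
    - apply continuous_orbit. intros k _. apply Hzd.
    - apply continuous_cot_half_arg, cot_half_arg_orbit_bound; assumption. }
  { intros z Hz. destruct (Hsq z Hz). apply cot_half_arg_orbit_bound; assumption. }
  destruct (Hsq z Hz) as [Hzd Hzo].
  destruct (orbit_cot_slope n z Hzd Hzo) as [eta [l [Hl [Hhalf Heta]]]];
    [apply cot_half_arg_orbit_bound; assumption | ].
  specialize (Hslope eta l Hl). fold K in Hslope.
  assert (Hrn : 0 < rate lam ^ n) by (apply pow_lt; lra).
  assert (HetaD : Cmod eta <= (/ rate lam) ^ n * D).
  { rewrite pow_inv. apply Rmult_le_reg_l with (rate lam ^ n); [exact Hrn | ].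
    rewrite <- Rmult_assoc, Rinv_r, Rmult_1_l by lra. apply Rle_trans with (1 := Heta).
    apply Rmult_le_compat_r; [lra | apply Cmod_square_le, Hz]. }
  assert (K * Cmod eta <= K * ((/ rate lam) ^ n * D)) by (apply Rmult_le_compat_l; lra).
  lra.
Qed.

Lemma locally_in_basin (z : C) (n : nat) : avoids_pole lam z ->
  Cmod (orbit lam n z) < trap_radius lam ->
  locally z (fun w => avoids_pole lam w /\ Cmod (orbit lam n w) < trap_radius lam).
Proof.
  intros Hz Hn.
  assert (Hfinite : forall m,
    locally z (fun w => forall k, (k < m)%nat -> orbit lam k w <> RtoC (-1))).
  { induction m as [ | m IH]; [apply filter_forall; intros w k Hk; lia | ].
    assert (Hm : locally z (fun w => 0 < sq_dist_pole (orbit lam m w))).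
    { apply (locally_gt (fun w => sq_dist_pole (orbit lam m w)));
        [ | apply sq_dist_pole_pos, Hz].
      apply (continuous_comp (orbit lam m) sq_dist_pole).
      - apply continuous_orbit. intros k _. apply Hz.
      - unfold sq_dist_pole. solve_continuous. }
    generalize (filter_and _ _ IH Hm). apply filter_imp. intros w [Hlt Heq] k Hk E.
    destruct (Nat.eq_dec k m) as [-> | Hkm]; [ | apply (Hlt k); [lia | exact E]].
    rewrite E in Heq. unfold sq_dist_pole in Heq. simpl in Heq. lra. }
  generalize (filter_and _ _ (Hfinite n) (locally_lt _ _ _ (continuous_Cmod_orbit n z Hz) Hn)).
  apply filter_imp. intros w [Hw Hwn]. split; [ | exact Hwn].
  intros k. destruct (Nat.lt_ge_cases k n) as [Hk | Hk]; [apply Hw, Hk | ].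
  replace k with ((k - n) + n)%nat by lia. rewrite orbit_add.
  apply trapped_neq_pole, orbit_trap, Hwn.
Qed.

(** * Iterates on the sphere and the Fatou set *)

Lemma zeta_step_finite (z : C) : z <> RtoC (-1) ->
  zeta_step lam (Some z) = Some (Some (zeta lam z)).
Proof.
  intros Hz. unfold zeta_step. destruct (Req_EM_T _ 0) as [E | _]; [ | reflexivity].
  exfalso. apply (Cplus_1_neq_0 z Hz), Cmod_eq_0, E.
Qed.

Lemma zeta_step_pole : zeta_step lam (Some (RtoC (-1))) = Some None.
Proof.
  unfold zeta_step. destruct (Req_EM_T _ 0) as [_ | E]; [reflexivity | ].
  exfalso. apply E. rewrite <- RtoC_plus, Cmod_R. replace (-1 + 1) with 0 by ring. apply Rabs_R0.
Qed.

Lemma zeta_iter_finite (n : nat) (z : C) : (forall k, (k < n)%nat -> orbit lam k z <> RtoC (-1)) ->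
  zeta_iter lam n (Some z) = Some (Some (orbit lam n z)).
Proof.
  induction n as [ | n IH]; intros Hz; [reflexivity | ].
  simpl. rewrite IH by (intros; apply Hz; lia). apply zeta_step_finite, Hz. lia.
Qed.

Lemma zeta_iter_defined (z : C) :
  (forall n, zeta_iter lam n (Some z) <> None) <-> avoids_pole lam z.
Proof.
  split; intros Hdef n.
  - induction n as [n IH] using lt_wf_ind. intros E. apply (Hdef (S (S n))).
    simpl. rewrite zeta_iter_finite by exact IH. rewrite E, zeta_step_pole. reflexivity.
  - rewrite zeta_iter_finite by (intros; apply Hdef). discriminate.
Qed.

Lemma zeta_iter_val_finite (n : nat) (z : C) : avoids_pole lam z ->
  zeta_iter_val lam n (Some z) = Some (orbit lam n z).
Proof.
  intros Hz. unfold zeta_iter_val. rewrite zeta_iter_finite; [reflexivity | intros; apply Hz].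
Qed.

Lemma chord_0_le (z : C) : chord (Some z) (Some (RtoC 0)) <= 2 * Cmod z.
Proof. replace z with (z - 0)%C at 2 by ring. apply chord_le. Qed.

Lemma chord_0_near (eps : R) : 0 < eps ->
  exists r, 0 < r /\ forall z, chord (Some z) (Some (RtoC 0)) < r -> Cmod z < eps.
Proof.
  intros Heps.
  destruct (chord_ball_of_locally (RtoC 0) (fun z => Cmod z < eps)) as [r [Hr Hnear]].
  { apply locally_lt; [apply continuous_Cmod | rewrite Cmod_0; exact Heps]. }
  exists r. split; [exact Hr | ]. intros z Hz. rewrite chord_sym in Hz.
  destruct (Hnear _ Hz) as [u [Eu Hu]]. injection Eu as ->. exact Hu.
Qed.

Lemma in_basin_iff_basin0 (z : C) : in_basin lam z <-> basin0 lam (Some z).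
Proof.
  split.
  - intros [Hz [n Hn]]. split; [apply zeta_iter_defined, Hz | ].
    intros eps Heps. destruct (eventually_trapped_orbit_lt n (eps / 2)) as [N HN]; [lra | ].
    exists N. intros j Hj. rewrite zeta_iter_val_finite by exact Hz.
    specialize (HN j Hj z Hn). assert (Hle := chord_0_le (orbit lam j z)). lra.
  - intros [Hz Hlim]. apply zeta_iter_defined in Hz. split; [exact Hz | ].
    destruct (chord_0_near (trap_radius lam)) as [r [Hr Hnear]]; [apply trap_radius_bounds | ].
    destruct (Hlim r Hr) as [N HN]. exists N. apply Hnear.
    rewrite <- zeta_iter_val_finite by exact Hz. apply HN, Nat.le_refl.
Qed.

Lemma in_basin_Fatou (z : C) : in_basin lam z -> Fatou lam (Some z).
Proof.
  intros [Hz [n Hn]].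
  destruct (chord_ball_of_locally z _ (locally_in_basin z n Hz Hn)) as [r [Hr Hball]].
  exists r. split; [exact Hr | split].
  - intros k v Hv. destruct (Hball v Hv) as [u [-> [Hu _]]]. apply zeta_iter_defined, Hu.
  - intros m. destruct (nat_seq_dichotomy m) as [[j [phi [Hphi Hj]]] | Hinf].
    + exists phi, (zeta_iter_val lam j). split; [exact Hphi | ].
      intros w Hw. destruct (chord_ball_open _ _ _ Hw) as [r' [Hr' Hsub]].
      exists r'. split; [exact Hr' | split; [exact Hsub | ]].
      intros eps Heps. exists O. intros k _ v _. rewrite Hj, chord_refl. exact Heps.
    + exists (fun k => k), (fun _ => Some (RtoC 0)). split; [intros; lia | ].
      intros w Hw. destruct (chord_ball_open _ _ _ Hw) as [r' [Hr' Hsub]].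
      exists r'. split; [exact Hr' | split; [exact Hsub | ]].
      intros eps Heps. destruct (eventually_trapped_orbit_lt n (eps / 2)) as [J HJ]; [lra | ].
      destruct (Hinf _ (ex_intro _ J HJ)) as [N HN]. exists N. intros k Hk v Hv.
      destruct (Hball v (Hsub v Hv)) as [u [-> [Hu Hun]]].
      rewrite zeta_iter_val_finite by exact Hu.
      specialize (HN k Hk u Hun). assert (Hle := chord_0_le (orbit lam (m k) u)). lra.
Qed.

(* If [z] is not in the basin, the iterates keep it away from [0]. One iterate close to the limit
   function then keeps a whole neighbourhood of [z] away from [0], and by uniform closeness no
   point of it tends to [0], against the density of the basin. *)
Lemma Fatou_in_basin (z : C) : Fatou lam (Some z) -> in_basin lam z.
Proof.
  intros [r [Hr [Hdef Hnormal]]]. apply NNPP. intros Hout.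
  assert (Hfinite : locally z (avoids_pole lam)).
  { generalize (locally_chord_ball z r Hr). apply filter_imp.
    intros w Hw. apply zeta_iter_defined. intros n. apply Hdef, Hw. }
  apply (basin_dense z Hfinite).
  assert (Hz := locally_singleton _ _ Hfinite). assert (Hd := trap_radius_bounds).
  destruct (Hnormal (fun k => k)) as [phi [g [Hphi Hcvg]]].
  destruct (Hcvg (Some z)) as [r' [Hr' [_ Hunif]]];
    [unfold chord_ball; rewrite chord_refl; exact Hr | ].
  destruct (chord_0_near (trap_radius lam / 2)) as [rho [Hrho Hnear]]; [lra | ].
  destruct (Hunif (rho / 3)) as [N HN]; [lra | ].
  assert (Hfar : locally z (fun w => trap_radius lam / 2 < Cmod (orbit lam (phi N) w))).
  { apply locally_gt; [apply continuous_Cmod_orbit, Hz | ].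
    destruct (orbit_outside_basin z (phi N) Hz Hout). lra. }
  generalize (filter_and _ _ (filter_and _ _ Hfinite (locally_chord_ball z r' Hr')) Hfar).
  apply filter_imp. intros w [[Hw Hball] Hwfar] Hin.
  destruct (proj1 (in_basin_iff_basin0 w) Hin) as [_ Hlim].
  destruct (Hlim (rho / 3)) as [J HJ]; [lra | ].
  destruct (eventually_subseq phi Hphi _ (ex_intro _ J (fun j Hj => Hj))) as [K HK].
  set (k := max K N).
  assert (HkN := HN k (Nat.le_max_r K N) _ Hball).
  assert (HNN := HN N (Nat.le_refl N) _ Hball).
  assert (Hk0 := HJ _ (HK k (Nat.le_max_l K N))).
  rewrite zeta_iter_val_finite in HkN, HNN, Hk0 by exact Hw.
  rewrite chord_sym in HkN.
  assert (Htri1 := chord_triangle (Some (orbit lam (phi N) w)) (g (Some w)) (Some (RtoC 0))).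
  assert (Htri2 := chord_triangle (g (Some w)) (Some (orbit lam (phi k) w)) (Some (RtoC 0))).
  assert (Hclose := Hnear (orbit lam (phi N) w)). lra.
Qed.

End Dynamics.

Theorem theorem5 (lam : R) (Hlam0 : 0 < lam) (Hlam1 : lam < 1) :
  forall w : Chat, Julia lam w <-> ~ basin0 lam w.
Proof.
  assert (Hlam : 0 < lam < 1) by (split; assumption).
  intros [z | ]; unfold Julia.
  - rewrite <- (in_basin_iff_basin0 lam Hlam).
    assert (Hiff : Fatou lam (Some z) <-> in_basin lam z)
      by (split; [apply Fatou_in_basin | apply in_basin_Fatou]; exact Hlam).
    rewrite Hiff. reflexivity.
  - split; intros _.
    + intros [Hdef _]. apply (Hdef 1%nat). reflexivity.
    + intros [r [Hr [Hdef _]]]. apply (Hdef 1%nat None); [ | reflexivity].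
      unfold chord_ball. rewrite chord_refl. exact Hr.
Qed.
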